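(* Let $H>0$ and let $\Phi:\{2,3,4,\dots\}\to(0,\infty)$ be an increasing function. Then the set of Dirichlet polynomials (as functions of $t\in(0,H)$) $$\left\{\sum_{n=2}^N a_n n^{it-1}:\ N\ge 2,\ a_n\in\mathbb{C},\ |a_n|\le \Phi(n)\right\}$$ is dense in $L^2(0,H)$ if and only if $$\sum_{n=2}^\infty \frac{\log\Phi(n)}{n\log^2 n}=\infty .$$
   Context: $L^2(0,H)$ is the Hilbert space of complex-valued square-integrable functions on $(0,H)$. *)

(* Defs.v *)
From HB Require Import structures.
From mathcomp Require Import all_boot all_order all_algebra.
From mathcomp Require Import complex.
From mathcomp Require Import all_classical all_reals all_analysis.
Set Implicit Arguments.
Unset Strict Implicit.
Unset Printing Implicit Defensive.
Import Order.TTheory GRing.Theory Num.Theory.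
Import numFieldNormedType.Exports.
Local Open Scope classical_set_scope.
Local Open Scope complex_scope.
Local Open Scope ring_scope.

Definition cexp (R : realType) (z : R[i]) : R[i] :=
  (expR (complex.Re z))%:C
  * (cos (complex.Im z) +i* sin (complex.Im z)).

(* [natcpow n s] is n^s = exp(s log n), meant for n >= 1. *)
Definition natcpow (R : realType) (n : nat) (s : R[i]) : R[i] :=
  cexp (s * (ln (n%:R : R))%:C).

(* The norm [`|z|] of [R[i]] takes its values in [R[i]];
   [ComplexField.Normc.normc] is the same modulus with values in [R].
   [\_] replaces the values of the function outside ]0, H[ by 0. *)
Definition L2norm (R : realType) (H : R) (f : R -> R[i]) : \bar R :=
  'N[lebesgue_measure]_2%:E[
    (fun t => (ComplexField.Normc.normc (f t))%:E) \_ `]0%R, H[%classic]%E.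

(* Representatives of the elements of L^2(0,H), before identification of
   functions that agree almost everywhere on ]0, H[. Measurability is Borel:
   every Lebesgue measurable class has a Borel representative. *)
Definition L2 (R : realType) (H : R) : set (R -> R[i]) :=
  [set f | [/\ measurable_fun `]0, H[ (fun t => complex.Re (f t)),
               measurable_fun `]0, H[ (fun t => complex.Im (f t))
             & (L2norm H f < +oo)%E]].

(* [L2norm] is constant on almost-everywhere classes, so this is density of
   the set of classes of elements of [S] in the quotient. *)
Definition dense_in_L2 (R : realType) (H : R) (S : set (R -> R[i])) : Prop :=
  S `<=` L2 H /\
  forall f, L2 H f -> forall e : R, 0 < e ->
    exists2 g, S g & (L2norm H (fun t => (f t - g t)%R) < e%:E)%E.

Definition dirichlet_polys (R : realType) (Phi : nat -> R) : set (R -> R[i]) :=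
  [set P | exists (N : nat) (a : nat -> R[i]),
     [/\ (2 <= N)%N,
         forall n, (2 <= n <= N)%N -> ComplexField.Normc.normc (a n) <= Phi n
       & P = fun t => \sum_(2 <= n < N.+1) a n * natcpow n ('i%C * t%:C - 1)]].

(* Main.v *)
Require Import Defs.
From HB Require Import structures.
From mathcomp Require Import all_boot all_order all_algebra.
From mathcomp Require Import complex.
From mathcomp Require Import all_classical all_reals all_analysis.
From mathcomp Require Import measurable_realfun ring lra.
Set Implicit Arguments.
Unset Strict Implicit.
Unset Printing Implicit Defensive.
Import Order.TTheory GRing.Theory Num.Theory.
Import numFieldNormedType.Exports.
Local Open Scope classical_set_scope.
Local Open Scope complex_scope.
Local Open Scope ring_scope.

(** Suppose the series diverges. Let [G = exp q], with [q] a combination of the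
    functions [g (z / (8 U_k))], where [U_k] is the logarithm of [2^(64^k)] and
    [g] is one fixed function, bounded and analytic in the upper half-plane and
    with real part positive on the real axis only between 1/8 and 8. The weights
    keep [|G u|] below [max (1, Phi n)] and of order at most [n] for [u] near
    [log n], while [|G (i y)|] is unbounded precisely because the series
    diverges. The Poisson mean of [G u * exp (i t u)] divided by [G (i y)] is
    [exp (- y t)]. It is discretised on the disc by averaging over the [m]-th
    roots of -1, and each abscissa [u] is replaced by the nearest smaller
    [log n]; this gives a Dirichlet polynomial whose coefficients are below an
    arbitrarily small multiple of [Phi]. Hence every polynomial in [exp (- t)]
    without constant term is a limit of such polynomials, and these are dense
    in [L^2].

    Suppose the series is bounded. Averaging [f t] and [f (t + e)] multiplies
    [n^(it)] by [(1 + n^(ie)) / 2], of modulus at most [1 / sqrt 2] when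
    [e log n] lies between [pi / 2] and [pi]. Repeating this about [log Phi n]
    times on each dyadic range of [log n] costs a total shift controlled by the
    series, so starting far enough it is at most [H / 2], and the averages of
    all admissible Dirichlet polynomials are bounded by one constant. Averaging
    preserves constants and does not increase the integral of the square beyond
    that over [(0, H)], so large constants cannot be approximated. *)

Local Notation normc := (@ComplexField.Normc.normc _).
#[local] Arguments ComplexField.Normc.normc : simpl never.

(** * The complex exponential *)

Section Complex.
Context {R : realType}.
Implicit Types (x y : R) (z w : R[i]).

Lemma normc_ge0 z : 0 <= normc z.
Proof. by case: z => a b; exact: sqrtr_ge0. Qed.

Lemma sqr_normc_ReIm z :
  normc z ^+ 2 = complex.Re z ^+ 2 + complex.Im z ^+ 2.
Proof. by case: z => a b; rewrite /ComplexField.Normc.normc/= sqr_sqrtr// addr_ge0// sqr_ge0. Qed.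

Lemma normc_Re_le z : `|complex.Re z| <= normc z.
Proof.
rewrite -ler_sqr ?nnegrE ?normc_ge0 ?normr_ge0// real_normK ?num_real//.
by rewrite sqr_normc_ReIm lerDl sqr_ge0.
Qed.

Lemma normc_Im_le z : `|complex.Im z| <= normc z.
Proof.
rewrite -ler_sqr ?nnegrE ?normc_ge0 ?normr_ge0// real_normK ?num_real//.
by rewrite sqr_normc_ReIm lerDr sqr_ge0.
Qed.

Lemma normc_le_ReIm z : normc z <= `|complex.Re z| + `|complex.Im z|.
Proof.
rewrite -ler_sqr ?nnegrE ?normc_ge0 ?addr_ge0// sqr_normc_ReIm sqrrD.
by rewrite !real_normK ?num_real// addrAC lerDl mulrn_wge0// mulr_ge0.
Qed.

Lemma normc_real x : normc x%:C = `|x|.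
Proof. by rewrite /ComplexField.Normc.normc /= expr0n/= addr0 sqrtr_sqr. Qed.

Lemma normcMe z w : normc (z * w) = normc z * normc w.
Proof. exact: ComplexField.Normc.normcM. Qed.

Lemma normcVe z : normc z^-1 = (normc z)^-1.
Proof. exact: ComplexField.Normc.normcV. Qed.

Lemma normc_D_le z w : normc (z + w) <= normc z + normc w.
Proof. exact: le_normcD. Qed.

Lemma normc_opp z : normc (- z) = normc z.
Proof. exact: normcN. Qed.

Lemma normc_B_le z w : normc (z - w) <= normc z + normc w.
Proof. by rewrite -(normc_opp w); exact: normc_D_le. Qed.

Lemma normc_distC z w : normc (z - w) = normc (w - z).
Proof. by rewrite -normc_opp opprB. Qed.

Lemma normc_B_trans u z w : normc (z - w) <= normc (z - u) + normc (u - w).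
Proof. by rewrite -{1}(subrKA u); exact: normc_D_le. Qed.

Lemma normc_zero : normc (0 : R[i]) = 0.
Proof. by rewrite -[0]/(0%:C) normc_real normr0. Qed.

Lemma normc_one : normc (1 : R[i]) = 1.
Proof. by rewrite -[1]/(1%:C) normc_real normr1. Qed.

Lemma normc_sum I (r : seq I) (P : pred I) (F : I -> R[i]) :
  normc (\sum_(i <- r | P i) F i) <= \sum_(i <- r | P i) normc (F i).
Proof.
elim/big_ind2 : _ => [|a b c d ab cd|//]; first by rewrite normc_zero.
by rewrite (le_trans (normc_D_le _ _))// lerD.
Qed.

Lemma normc_exp z n : normc (z ^+ n) = normc z ^+ n.
Proof.
elim: n => [|n ih]; first by rewrite !expr0 normc_one.
by rewrite !exprS normcMe ih.
Qed.

Lemma normc_eq0 z : (normc z == 0) = (z == 0).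
Proof.
apply/eqP/eqP => [|->]; last exact: normc_zero.
exact: ComplexField.Normc.eq0_normc.
Qed.

Lemma normc_gt0 z : (0 < normc z) = (z != 0).
Proof. by rewrite lt_neqAle normc_ge0 andbT eq_sym normc_eq0. Qed.

Lemma normc_div z w : normc (z / w) = normc z / normc w.
Proof. by rewrite normcMe normcVe. Qed.

Lemma natr_realc n : (n%:R : R[i]) = (n%:R : R)%:C.
Proof. by rewrite rmorph_nat. Qed.

Lemma normc_nat n : normc (n%:R : R[i]) = n%:R.
Proof. by rewrite natr_realc normc_real ger0_norm. Qed.

Lemma normc_subX_le z w (M : R) n : normc z <= M -> normc w <= M ->
  normc (z ^+ n - w ^+ n) <= n%:R * M ^+ n.-1 * normc (z - w).
Proof.
move=> zM wM; have M0 : 0 <= M := le_trans (normc_ge0 _) zM.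
rewrite subrXX normcMe mulrC ler_wpM2r ?normc_ge0//.
apply: le_trans (normc_sum _ _ _) _.
rewrite mulr_natl -[X in _ *+ X](card_ord n) -sumr_const.
apply: ler_sum => i _; rewrite normcMe !normc_exp.
have -> : n.-1 = (n.-1 - i + i)%N by rewrite subnK// -ltnS (ltn_predK (ltn_ord i)).
rewrite exprD -subn1 subnAC subn1 addnK.
by apply: ler_pM; rewrite ?exprn_ge0 ?normc_ge0// lerXn2r// ?nnegrE ?normc_ge0.
Qed.

Lemma MVT_bound (f f' : R -> R) (M x : R) :
  (forall t, is_derive t (1:R) f (f' t)) ->
  (forall t, `|t| <= `|x| -> `|f' t| <= M) ->
  `|f x - f 0| <= M * `|x|.
Proof.
move=> fd f'M.
have fc a b : {within `[a, b], continuous f}.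
  apply: continuous_subspaceT => t; apply: differentiable_continuous.
  by apply/derivable1_diffP; have [] := fd t.
have [x0|x0] := leP x 0.
- have [c /[!in_itv]/= /andP[c1 c2] e] := MVT_segment x0 (fun t _ => fd t) (fc _ _).
  rewrite distrC e sub0r normrM normrN ler_wpM2r// f'M//.
  by rewrite !ler0_norm// lerN2.
- have [c /[!in_itv]/= /andP[c1 c2] e] := MVT_segment (ltW x0) (fun t _ => fd t) (fc _ _).
  rewrite e subr0 normrM ler_wpM2r// f'M//.
  by rewrite !ger0_norm// (le_trans c1).
Qed.

Lemma expR1_le4 : expR 1 <= 4 :> R.
Proof.
have h : expR (- (1/2)) >= 1/2 :> R.
  by apply: le_trans (expR_ge1Dx _); lra.
have -> : expR 1 = expR (1/2) * expR (1/2) :> R by rewrite -expRD; congr expR; lra.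
have e0 := expR_gt0 (1/2 : R); have := expRxMexpNx_1 (1/2 : R).
by nra.
Qed.

Lemma expR_sub1_le x : `|x| <= 1 -> `|expR x - 1| <= 4 * `|x|.
Proof.
move=> x1; rewrite -[X in _ - X]expR0; apply: (@MVT_bound _ expR) => t tx.
rewrite ger0_norm ?expR_ge0// (le_trans _ expR1_le4)// ler_expR.
by rewrite (le_trans (ler_norm _))// (le_trans tx).
Qed.

Lemma expR_taylor2_le x : `|x| <= 1 -> `|expR x - 1 - x| <= 4 * `|x| ^+ 2.
Proof.
move=> x1.
have -> : expR x - 1 - x = (expR x - x) - (expR 0 - 0) by rewrite expR0; ring.
rewrite expr2 mulrA.
apply: (@MVT_bound (fun t => expR t - t) (fun t => expR t - 1)) => t tx.
rewrite (le_trans (expR_sub1_le _)) ?(le_trans tx)// ler_wpM2l//.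
Qed.

Lemma normr_sin_le x : `|sin x| <= `|x|.
Proof.
rewrite -[sin x]subr0 -[X in _ - X](@sin0 R) -[leRHS]mul1r.
by apply: (@MVT_bound _ cos) => t _; exact: cos_max.
Qed.

Lemma normr_cos_sub1_le x : `|cos x - 1| <= `|x| ^+ 2.
Proof.
rewrite -[X in _ - X]cos0 expr2.
apply: (@MVT_bound cos (fun t => - sin t)) => t tx.
by rewrite normrN (le_trans (normr_sin_le _)).
Qed.

Lemma normr_sin_taylor_le x : `|x| <= 1 -> `|sin x - x| <= `|x| ^+ 2.
Proof.
move=> x1.
have -> : sin x - x = (sin x - x) - (sin 0 - 0) by rewrite sin0; ring.
rewrite expr2.
apply: (@MVT_bound (fun t => sin t - t) (fun t => cos t - 1)) => t tx.
rewrite (le_trans (normr_cos_sub1_le _))// expr2.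
by rewrite (le_trans (ler_pM _ _ tx (le_trans tx x1)))// mulr1.
Qed.

Lemma cexpE x y : cexp (x +i* y) = (expR x * cos y) +i* (expR x * sin y).
Proof. by rewrite /cexp /=; simpc. Qed.

Lemma cexpD z w : cexp (z + w) = cexp z * cexp w.
Proof.
case: z w => a b [c d]; simpc; rewrite !cexpE; simpc.
by rewrite expRD cosD sinD; congr (_ +i* _); ring.
Qed.

Lemma cexp0 : cexp (0 : R[i]) = 1.
Proof. by rewrite -[0]/(0 +i* 0) cexpE expR0 cos0 sin0 mul1r mulr0. Qed.

Lemma cexpMn z n : cexp (z *+ n) = cexp z ^+ n.
Proof. by elim: n => [|n ih]; rewrite ?mulr0n ?cexp0// mulrS cexpD ih exprS. Qed.

Lemma normc_cexp z : normc (cexp z) = expR (complex.Re z).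
Proof.
apply/eqP; rewrite -(eqrXn2 (n:=2))// ?normc_ge0 ?expR_ge0// sqr_normc_ReIm.
by case: z => a b; rewrite cexpE /= !exprMn -mulrDr cos2Dsin2 mulr1.
Qed.

Lemma cexp_neq0 z : cexp z != 0.
Proof. by rewrite -normc_gt0 normc_cexp expR_gt0. Qed.

Lemma cexp_real x : cexp x%:C = (expR x)%:C.
Proof. by rewrite cexpE cos0 sin0 mulr1 mulr0. Qed.

Lemma cexp_taylor2_le z : normc z <= 1 ->
  normc (cexp z - 1 - z) <= 6 * normc z ^+ 2.
Proof.
move=> z1; rewrite sqr_normc_ReIm.
have := le_trans (normc_Re_le _) z1; have := le_trans (normc_Im_le _) z1.
case: z {z1} => a b /= b1 a1; apply: le_trans (normc_le_ReIm _) _.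
rewrite cexpE /=; simpc => /=.
have -> : expR a * cos b - 1 - a = (expR a - 1 - a) * cos b + (1 + a) * (cos b - 1).
  by ring.
have -> : expR a * sin b - b = (expR a - 1) * sin b + (sin b - b) by ring.
have H1 : `|(expR a - 1 - a) * cos b| <= 4 * `|a| ^+ 2.
  rewrite normrM -[leRHS]mulr1 ler_pM// ?expR_taylor2_le//; exact: cos_max.
have H2 : `|(1 + a) * (cos b - 1)| <= 2 * `|b| ^+ 2.
  rewrite normrM ler_pM// ?normr_cos_sub1_le//.
  by rewrite (le_trans (ler_normD _ _))// normr1; lra.
have H3 : `|(expR a - 1) * sin b| <= 4 * `|a| * `|b|.
  by rewrite normrM ler_pM// ?expR_sub1_le// normr_sin_le.
have H4 := normr_sin_taylor_le b1.
have := ler_normD ((expR a - 1 - a) * cos b) ((1 + a) * (cos b - 1)).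
have := ler_normD ((expR a - 1) * sin b) (sin b - b).
have -> : a ^+ 2 = `|a| ^+ 2 by rewrite real_normK ?num_real.
have -> : b ^+ 2 = `|b| ^+ 2 by rewrite real_normK ?num_real.
have := sqr_ge0 (`|a| - `|b|).
by move: H1 H2 H3 H4; rewrite !expr2; nra.
Qed.

Lemma normc_cexp_le1 z : complex.Re z <= 0 -> normc (cexp z) <= 1.
Proof. by move=> z0; rewrite normc_cexp -expR0 ler_expR. Qed.

Lemma normc_cexp_sub_le z w : complex.Re z <= 0 -> complex.Re w <= 0 ->
  normc (cexp z - cexp w) <= normc (z - w).
Proof.
move=> z0 w0.
pose B := normc z ^+ 2 + normc w ^+ 2.
have B0 : 0 <= B by rewrite addr_ge0 ?sqr_ge0.
(* telescoping over n-th roots upgrades the first-order expansion at 0 to a global Lipschitz bound *)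
have H n : normc z <= n.+1%:R -> normc w <= n.+1%:R ->
    normc (cexp z - cexp w) <= normc (z - w) + 6 * B / n.+1%:R.
  move=> zn wn; have n0 : 0 < n.+1%:R :> R by [].
  have nn (u : R[i]) : normc (u / n.+1%:R) = normc u / n.+1%:R :> R.
    by rewrite normc_div normc_nat.
  have rn (u : R[i]) : complex.Re u <= 0 -> normc (cexp (u / n.+1%:R)) <= 1.
    move=> u0; apply: normc_cexp_le1; rewrite natr_realc -fmorphV/=.
    by case: u u0 => a b /= a0; simpc; rewrite /= pmulr_lle0 // invr_gt0.
  have E (u : R[i]) : cexp u = cexp (u / n.+1%:R) ^+ n.+1 :> R[i].
    by rewrite -cexpMn -(mulr_natr (u / _)) divfK// pnatr_eq0.
  rewrite (E z) (E w) (le_trans (normc_subX_le _ (rn _ z0) (rn _ w0)))//.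
  rewrite expr1n mulr1 -ler_pdivlMl// [leRHS]mulrC.
  have T (u : R[i]) : normc u <= n.+1%:R ->
      normc (cexp (u / n.+1%:R) - 1 - u / n.+1%:R) <= 6 * (normc u / n.+1%:R) ^+ 2.
    by move=> un; rewrite -nn cexp_taylor2_le// nn ler_pdivrMr ?mul1r.
  have -> : cexp (z / n.+1%:R) - cexp (w / n.+1%:R) =
     (cexp (z / n.+1%:R) - 1 - z / n.+1%:R) - (cexp (w / n.+1%:R) - 1 - w / n.+1%:R) + (z - w) / n.+1%:R.
    by ring.
  rewrite (le_trans (normc_D_le _ _))// nn.
  have := normc_B_le (cexp (z / n.+1%:R) - 1 - z / n.+1%:R) (cexp (w / n.+1%:R) - 1 - w / n.+1%:R).
  move: (T _ zn) (T _ wn); rewrite /B !expr_div_n !expr2.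
  move: (normc z) (normc w) => p q h1 h2 h3.
  rewrite [leRHS](_ : _ = normc (z - w) / n.+1%:R +
    (6 * (p * p / (n.+1%:R * n.+1%:R)) + 6 * (q * q / (n.+1%:R * n.+1%:R)))).
    by rewrite [leRHS]addrC lerD2r (le_trans h3)// lerD.
  by move: n0; move: (n.+1%:R : R) => N N0; field; rewrite gt_eqF.
apply/ler_addgt0Pr => e e0.
have [n nP] : exists n : nat, normc z + normc w + 6 * B / e <= n.+1%:R.
  exists (Num.trunc (normc z + normc w + 6 * B / e)).
  by rewrite ltW// truncnS_gt.
have Be : 0 <= 6 * B / e by rewrite divr_ge0 ?mulr_ge0// ltW.
apply: le_trans (H n _ _) _.
- by have := normc_ge0 w; lra.
- by have := normc_ge0 z; lra.
rewrite lerD2l ler_pdivrMr// -ler_pdivrMl// mulrC.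
by have := normc_ge0 z; have := normc_ge0 w; lra.
Qed.

End Complex.

(** * Polynomial approximation and means on the unit circle *)

Section DiscAlgebra.
Context {R : realType} {T : Type} (D : set T).
Implicit Types (f g : T -> R[i] -> R[i]) (e : R) (v : R[i]).

Definition disc_bounded f :=
  exists2 M : R, 0 <= M & forall t v, D t -> normc v <= 1 -> normc (f t v) <= M.

(* The degree is uniform in the parameter [t], so that averages over roots of
   unity converge uniformly in [t]. *)
Definition disc_approx f := disc_bounded f /\
  forall e, 0 < e -> exists d, forall t, D t ->
    exists2 p : {poly R[i]}, (size p <= d)%N &
      forall v, normc v <= 1 -> normc (f t v - p.[v]) <= e.

Lemma disc_approx_lim f :
  (forall e, 0 < e -> exists2 g, disc_approx g &
     forall t v, D t -> normc v <= 1 -> normc (f t v - g t v) <= e) ->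
  disc_approx f.
Proof.
move=> H; split.
  have [g [[M M0 gM] _] fg] := H 1 ltr01.
  exists (M + 1) => [|t v Dt v1]; first by rewrite addr_ge0.
  rewrite -(subrK (g t v) (f t v)) (le_trans (normc_D_le _ _))// addrC lerD//.
    exact: gM.
  exact: fg.
move=> e e0; have e20 : 0 < e / 2 by rewrite divr_gt0.
have [g [_ /(_ _ e20)[d dP]] fg] := H _ e20.
exists d => t Dt; have [p sp pP] := dP t Dt; exists p => // v v1.
rewrite (le_trans (normc_B_trans (g t v) _ _))// (splitr e) lerD//.
  exact: fg.
exact: pP.
Qed.

Lemma disc_approx_cst (c : T -> R[i]) :
  (exists2 M : R, 0 <= M & forall t, D t -> normc (c t) <= M) ->
  disc_approx (fun t _ => c t).
Proof.
move=> [M M0 cM]; split; first by exists M => // t v Dt _; exact: cM.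
move=> e e0; exists 1%N => t Dt; exists (c t)%:P; first exact: size_polyC_leq1.
by move=> v _; rewrite hornerC subrr normc_zero ltW.
Qed.

Lemma disc_approx_const (c : R[i]) : disc_approx (fun _ _ => c).
Proof. by apply: disc_approx_cst; exists (normc c) => //; exact: normc_ge0. Qed.

Lemma disc_approx_id : disc_approx (fun _ v => v).
Proof.
split; first by exists 1.
move=> e e0; exists 2%N => t Dt; exists 'X; first by rewrite size_polyX.
by move=> v _; rewrite hornerX subrr normc_zero ltW.
Qed.

Lemma disc_approxD f g : disc_approx f -> disc_approx g ->
  disc_approx (fun t v => f t v + g t v).
Proof.
move=> [[M M0 fM] fA] [[N N0 gN] gA]; split.
  exists (M + N); first by rewrite addr_ge0.
  by move=> t v Dt v1; rewrite (le_trans (normc_D_le _ _))// lerD ?fM ?gN.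
move=> e e0; have e20 : 0 < e / 2 by rewrite divr_gt0.
have [d1 d1P] := fA _ e20; have [d2 d2P] := gA _ e20.
exists (maxn d1 d2) => t Dt.
have [p sp pP] := d1P t Dt; have [q sq qP] := d2P t Dt; exists (p + q).
  rewrite (leq_trans (size_polyD _ _))// geq_max !leq_max sp sq orbT//.
move=> v v1; rewrite hornerD opprD addrACA (le_trans (normc_D_le _ _))//.
by rewrite (splitr e) lerD ?pP ?qP.
Qed.

Lemma disc_approxM f g : disc_approx f -> disc_approx g ->
  disc_approx (fun t v => f t v * g t v).
Proof.
move=> [[M M0 fM] fA] [[N N0 gN] gA]; split.
  exists (M * N); first by rewrite mulr_ge0.
  by move=> t v Dt v1; rewrite normcMe ler_pM ?normc_ge0// ?fM ?gN.
move=> e e0.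
have S0 : 0 < M + N + 1 by rewrite ltr_wpDl// addr_ge0.
(* The cap at 1 bounds the polynomial that approximates [g] by [N + 1]; the quotient makes the total
   error [M * e' + e' * (N + 1)] at most [e]. *)
pose e' := Num.min 1 (e / (M + N + 1)).
have e'0 : 0 < e' by rewrite lt_min ltr01 divr_gt0.
have [d1 d1P] := fA _ e'0; have [d2 d2P] := gA _ e'0.
exists (d1 + d2)%N => t Dt.
have [p sp pP] := d1P t Dt; have [q sq qP] := d2P t Dt; exists (p * q).
  by rewrite (leq_trans (size_polyMleq _ _))// (leq_trans (leq_pred _))// leq_add.
move=> v v1; rewrite hornerM.
have -> : f t v * g t v - p.[v] * q.[v] =
  f t v * (g t v - q.[v]) + (f t v - p.[v]) * (g t v + (q.[v] - g t v)) by ring.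
rewrite (le_trans (normc_D_le _ _))// !normcMe.
have h1 := fM t v Dt v1; have h2 := pP v v1; have h3 := qP v v1.
have h4 := gN t v Dt v1; have h5 := normc_D_le (g t v) (q.[v] - g t v).
have h6 : e' <= 1 by rewrite ge_min lexx.
have h7 : e' * (M + N + 1) <= e by rewrite -ler_pdivlMr// ge_min lexx orbT.
move: h5; rewrite (normc_distC q.[v]) => h5.
have h8 : normc (g t v + (q.[v] - g t v)) <= N + 1.
  by apply: (le_trans h5); apply: lerD => //; exact: le_trans h6.
apply: le_trans h7.
have -> : e' * (M + N + 1) = M * e' + e' * (N + 1) by ring.
by apply: lerD; apply: ler_pM; rewrite ?normc_ge0.
Qed.

Lemma disc_approxN f : disc_approx f -> disc_approx (fun t v => - f t v).
Proof.
move=> fA; have := disc_approxM (disc_approx_const (-1)) fA.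
by under [fun t v => _ * _]eq_fun do under eq_fun do rewrite mulN1r.
Qed.

Lemma disc_approxX f n : disc_approx f -> disc_approx (fun t v => f t v ^+ n).
Proof.
move=> fA; elim: n => [|n ih].
  by under eq_fun do under eq_fun do rewrite expr0; exact: disc_approx_const.
by under eq_fun do under eq_fun do rewrite exprS; exact: disc_approxM.
Qed.

Lemma disc_approx_sum I (r : seq I) (F : I -> T -> R[i] -> R[i]) :
  (forall i, disc_approx (F i)) ->
  disc_approx (fun t v => \sum_(i <- r) F i t v).
Proof.
move=> FA; elim: r => [|i r ih].
  by under eq_fun do under eq_fun do rewrite big_nil; exact: disc_approx_const.
by under eq_fun do under eq_fun do rewrite big_cons; exact: disc_approxD.
Qed.

Lemma disc_approx_geometric (a : R[i]) : normc a < 1 ->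
  disc_approx (fun _ v => (1 - a * v)^-1).
Proof.
move=> a1; apply: disc_approx_lim => e e0.
have A0 : 0 < 1 - normc a by rewrite subr_gt0.
have : (fun n => normc a ^+ n) @ \oo --> (0 : R).
  by apply: cvg_expr; rewrite ger0_norm// normc_ge0.
move=> /cvgrPdist_lt /(_ (e * (1 - normc a)) (mulr_gt0 e0 A0))[n _ /(_ n (leqnn n))].
rewrite sub0r normrN ger0_norm ?exprn_ge0 ?normc_ge0// => an.
exists (fun _ v => \sum_(i < n) (a * v) ^+ i).
  apply: disc_approx_sum => i; apply: disc_approxX; apply: disc_approxM.
    exact: disc_approx_const.
  exact: disc_approx_id.
move=> t v _ v1.
have av : normc (a * v) <= normc a.
  by rewrite normcMe ler_piMr// normc_ge0.
have h : 1 - normc a <= normc (1 - a * v).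
  have := normc_D_le (1 - a * v) (a * v); rewrite subrK normc_one; lra.
have nz : 1 - a * v != 0 by rewrite -normc_gt0 (lt_le_trans A0).
have -> : (1 - a * v)^-1 - \sum_(i < n) (a * v) ^+ i = (a * v) ^+ n / (1 - a * v).
  apply: (mulIf nz); rewrite mulrBl mulVf// divfK// mulrC.
  have := subrXX 1 (a * v) n; rewrite expr1n => h'.
  rewrite -[RHS](subKr 1); congr (1 - _).
  by rewrite h'; congr (_ * _); apply: eq_bigr => i _; rewrite expr1n mul1r.
rewrite normc_div normc_exp ler_pdivrMr ?(lt_le_trans A0)//.
rewrite (@le_trans _ _ (normc a ^+ n))//.
  by rewrite lerXn2r// nnegrE normc_ge0.
by rewrite (le_trans (ltW an))// ler_wpM2l// ltW.
Qed.

(** Factoring out [a] leaves a geometric series in [v] of ratio [- (b / a)], whose modulus is below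
    1. *)
Lemma disc_approx_inv (a b : R[i]) : normc b < normc a ->
  disc_approx (fun _ v => (a + b * v)^-1).
Proof.
move=> ba.
have a0 : a != 0 by rewrite -normc_gt0 (le_lt_trans (normc_ge0 _) ba).
have := disc_approxM (disc_approx_const a^-1)
  (@disc_approx_geometric (- (b / a)) _).
rewrite normc_opp normc_div ltr_pdivrMr ?normc_gt0// mul1r => /(_ ba).
congr disc_approx; apply/funext => t; apply/funext => v.
by rewrite -invfM; congr (_^-1); field.
Qed.

(** The exponential is replaced by [(1 + f / n) ^+ n], a polynomial in [f]. Both are [n]-th powers
    of numbers of modulus at most [expR (M / n)] that differ by at most [6 (M / n)^2], so the error
    is at most [6 M^2 expR M / n]. *)
Lemma disc_approx_cexp f : disc_approx f ->
  disc_approx (fun t v => cexp (f t v)).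
Proof.
move=> fA; have [[M M0 fM] _] := fA; apply: disc_approx_lim => e e0.
have C0 : 0 <= 6 * M ^+ 2 * expR M by rewrite !mulr_ge0// expR_ge0.
(* The summand [M] ensures [M / n <= 1], as the Taylor bound requires; the other one brings the
   final error below [e]. *)
pose n := (Num.trunc (M + 6 * M ^+ 2 * expR M / e)).+1.
have nP : M + 6 * M ^+ 2 * expR M / e <= n%:R by rewrite ltW// truncnS_gt.
have n0 : 0 < n%:R :> R by rewrite ltr0n.
have Ce : 0 <= 6 * M ^+ 2 * expR M / e by rewrite divr_ge0// ltW.
exists (fun t v => (1 + n%:R^-1 * f t v) ^+ n).
  apply: disc_approxX; apply: disc_approxD; first exact: disc_approx_const.
  by apply: disc_approxM => //; exact: disc_approx_const.
move=> t v Dt v1; have fMv := fM t v Dt v1; set z := f t v in fMv *.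
have nz : normc (n%:R^-1 * z) = normc z / n%:R.
  by rewrite normcMe normcVe normc_nat mulrC.
have zn : normc (n%:R^-1 * z) <= M / n%:R by rewrite nz ler_pM2r ?invr_gt0.
have zn1 : normc (n%:R^-1 * z) <= 1.
  by rewrite (le_trans zn)// ler_pdivrMr// mul1r (le_trans _ nP)// lerDl.
have -> : cexp z = cexp (n%:R^-1 * z) ^+ n.
  by rewrite -cexpMn -(mulr_natl (_ * z)) mulVKf// natr_realc fmorph_eq0 gt_eqF.
have h1 : normc (cexp (n%:R^-1 * z)) <= expR (M / n%:R).
  rewrite normc_cexp ler_expR (le_trans _ zn)// (le_trans (ler_norm _))//.
  exact: normc_Re_le.
have h2 : normc (1 + n%:R^-1 * z) <= expR (M / n%:R).
  rewrite (le_trans (normc_D_le _ _))// normc_one.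
  by rewrite (le_trans _ (expR_ge1Dx _))// lerD2l.
apply: le_trans (normc_subX_le _ h1 h2) _.
have h3 : expR (M / n%:R) ^+ n.-1 <= expR M.
  rewrite -expRM_natr ler_expR mulrAC ler_pdivrMr// ler_wpM2l// ler_nat.
  exact: leq_pred.
have h4 : normc (cexp (n%:R^-1 * z) - (1 + n%:R^-1 * z)) <= 6 * (M / n%:R) ^+ 2.
  rewrite opprD addrA (le_trans (cexp_taylor2_le _))// ler_wpM2l// lerXn2r//.
    by rewrite nnegrE normc_ge0.
  by rewrite nnegrE divr_ge0// ltW.
apply: (@le_trans _ _ (n%:R * expR M * (6 * (M / n%:R) ^+ 2))).
  apply: ler_pM => //; last by rewrite ler_wpM2l// ltW.
  exact: normc_ge0.
rewrite [leLHS](_ : _ = 6 * M ^+ 2 * expR M / n%:R); last first.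
  by move: n0; move: (n%:R : R) => N N0; field; rewrite gt_eqF.
rewrite ler_pdivrMr// -ler_pdivrMl// mulrC (le_trans _ nP)// lerDr//.
Qed.

End DiscAlgebra.

Section CircleMean.
Context {R : realType}.
Implicit Types (x : R).

Definition cis x : R[i] := cexp (0 +i* x).

Lemma cisE x : cis x = cos x +i* sin x.
Proof. by rewrite /cis cexpE expR0 !mul1r. Qed.

Lemma normc_cis x : normc (cis x) = 1.
Proof. by rewrite normc_cexp expR0. Qed.

Lemma cisD x y : cis (x + y) = cis x * cis y.
Proof. by rewrite /cis -cexpD; congr cexp; simpc. Qed.

Lemma cisMn x n : cis (x *+ n) = cis x ^+ n.
Proof.
elim: n => [|n ih]; last by rewrite mulrS cisD ih exprS.
by rewrite mulr0n cisE cos0 sin0.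
Qed.

(** Half the argument of the [j]-th node. The Cayley transform sends [cis (2 a)] to [i cot a], so
    this is the angle in which boundary values are computed. *)
Definition half_angle (m j : nat) : R := pi * (j.*2.+1%:R) / (m.*2)%:R.

(* The [m]-th roots of [-1]: like the roots of unity, but avoiding [1], which
   the Cayley map sends to infinity. *)
Definition node (m j : nat) : R[i] := cis (half_angle m j *+ 2).

Lemma half_angle_itv m j : (j < m)%N -> 0 < half_angle m j < pi.
Proof.
move=> jm; have m0 : 0 < (m.*2)%:R :> R.
  by rewrite ltr0n double_gt0 (leq_ltn_trans _ jm).
rewrite divr_gt0 ?mulr_gt0 ?pi_gt0//= ltr_pdivrMr// ltr_pM2l ?pi_gt0//.
by rewrite ltr_nat -doubleS leq_double.
Qed.

(** The powers form a geometric progression whose ratio [w ^+ k] differs from 1 while its [m]-th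
    power is 1. *)
Lemma sum_node_pow m k : (0 < k < m)%N -> \sum_(j < m) node m j ^+ k = 0.
Proof.
move=> /andP[k0 km].
have m0 : (0 : R) < m%:R by rewrite ltr0n (ltn_trans k0).
pose w : R[i] := cis (pi / m%:R *+ 2).
have nodeE j : node m j ^+ k = node m 0 ^+ k * (w ^+ k) ^+ j.
  rewrite -exprM mulnC exprM -exprMn; congr (_ ^+ _).
  rewrite -cisMn -cisD; congr cis; rewrite /half_angle.
  have oddE i : (i.*2.+1)%:R = 2 * i%:R + 1 :> R.
    by rewrite -addn1 natrD -mul2n natrM.
  have m2 : (m.*2)%:R = 2 * m%:R :> R by rewrite -mul2n natrM.
  rewrite !oddE m2 -[_ *+ j]mulr_natr ![_ *+ 2]mulr2n mulr0 add0r.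
  by field; rewrite gt_eqF.
under eq_bigr do rewrite nodeE.
rewrite -mulr_sumr; apply/eqP; rewrite mulf_eq0; apply/orP; right.
have wm : (w ^+ k) ^+ m = 1.
  rewrite -exprM mulnC exprM -[w ^+ m]cisMn.
  have -> : pi / m%:R *+ 2 *+ m = pi *+ 2 :> R.
    by rewrite -[LHS]mulr_natr ![_ *+ 2]mulr2n; field; rewrite gt_eqF.
  by rewrite cisE cos2pi sin2pi expr1n.
(* The real part of [w ^+ k] is [1 - 2 sin^2 (pi k / m)], and the sine is positive because
   [0 < k < m]. *)
have wk : w ^+ k != 1.
  apply/eqP => /(congr1 (@complex.Re R)) /=; rewrite -cisMn cisE [complex.Re _]/=.
  rewrite -mulrnA mulnC mulrnA cos_mulr2n cos2sin2.
  have : 0 < sin (pi / m%:R *+ k) :> R.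
    apply: sin_gt0_pi; rewrite -[_ *+ k]mulr_natr mulr_gt0 ?divr_gt0 ?pi_gt0 ?ltr0n ?(ltn_trans k0 km)//=.
    by rewrite mulrAC ltr_pdivrMr// ltr_pM2l ?pi_gt0 ?ltr_nat// (ltn_trans k0 km).
  rewrite expr2; nra.
have := subrXX 1 (w ^+ k) m; rewrite expr1n wm subrr => /esym /eqP.
rewrite mulf_eq0 subr_eq0 eq_sym (negPf wk)/= => /eqP sum0; apply/eqP; rewrite -[RHS]sum0.
by apply: eq_bigr => i _; rewrite expr1n mul1r.
Qed.

(** The degree is below [m], so every power except the zeroth sums to zero over the nodes and only
    the constant coefficient survives. *)
Lemma poly_mean (p : {poly R[i]}) m : (0 < m)%N -> (size p <= m)%N ->
  m%:R^-1 * \sum_(j < m) p.[node m j] = p.[0].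
Proof.
move=> m0 sp.
have -> : \sum_(j < m) p.[node m j] = m%:R * p.[0].
  under eq_bigr do rewrite (horner_coef_wide _ sp).
  rewrite exchange_big/= (bigD1 (Ordinal m0))//=.
  rewrite -mulr_sumr (eq_bigr (fun=> 1)) => [|j _]; last by rewrite expr0.
  rewrite sumr_const card_ord horner_coef0 mulrC big1 ?addr0// => i i0.
  by rewrite -mulr_sumr sum_node_pow ?mulr0// ltn_ord lt0n andbT.
by rewrite mulKf// pnatr_eq0 -lt0n.
Qed.

(** A discrete mean value property. The mean is exact on an approximating polynomial of size at most
    [d < m]; passing to it costs [e / 2] at the nodes and [e / 2] at 0, uniformly in [t]. *)
Lemma disc_approx_mean T (D : set T) (f : T -> R[i] -> R[i]) (e : R) :
  disc_approx D f -> 0 < e ->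
  exists m0, forall m t, (m0 < m)%N -> D t ->
    normc (m%:R^-1 * \sum_(j < m) f t (node m j) - f t 0) <= e.
Proof.
move=> [_ fA] e0; have e20 : 0 < e / 2 by rewrite divr_gt0.
have [d dP] := fA _ e20; exists d => m t dm Dt; have [p sp pP] := dP t Dt.
have m0 : (0 < m)%N by rewrite (leq_ltn_trans _ dm).
have mR : 0 < m%:R :> R by rewrite ltr0n.
rewrite (le_trans (normc_B_trans p.[0] _ _))// (splitr e) lerD//; last first.
  by rewrite normc_distC pP ?normc_zero.
rewrite -(poly_mean m0 (leq_trans sp (ltnW dm))) -mulrBr -sumrB.
rewrite normcMe normcVe normc_nat ler_pdivrMl//.
apply: le_trans (normc_sum _ _ _) _.
rewrite -[m in leRHS]card_ord mulr_natl -sumr_const.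
by apply: ler_sum => j _; rewrite pP// normc_cis.
Qed.

End CircleMean.

(** * Bounded functions on the half-plane *)

Section HalfPlane.
Context {R : realType}.
Implicit Types (k v : R[i]) (b y s c a : R).

(* With [w = (1 + v) / (1 - v)], the Cayley transform from the disc to the
   right half-plane, [cayley k v] is [w / (1 + k w)]. *)
Definition cayley k v : R[i] := (1 + v) / ((1 - v) + k * (1 + v)).

(** The denominator is [(1 + k) + (k - 1) v], and a positive real part places [k] closer to 1 than
    to -1. *)
Lemma disc_approx_cayley T (D : set T) k : 0 < complex.Re k ->
  disc_approx D (fun _ v => cayley k v).
Proof.
move=> k0; have h : normc (k - 1) < normc (1 + k).
  rewrite -ltr_sqr ?nnegrE ?normc_ge0// !sqr_normc_ReIm.
  by case: k k0 => p q /= p0; rewrite !expr2; lra.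
apply: disc_approxM.
  by apply: disc_approxD; [exact: disc_approx_const|exact: disc_approx_id].
have := @disc_approx_inv R T D _ _ h.
congr disc_approx; apply/funext => t; apply/funext => v.
by congr (_^-1); ring.
Qed.

Lemma cayley0 k : cayley k 0 = (1 + k)^-1.
Proof. by rewrite /cayley addr0 subr0 mulr1 mul1r. Qed.

Lemma cayley_cis k a : cayley k (cis (a *+ 2)) =
  (cos a)%:C / (k * (cos a)%:C - 'i%C * (sin a)%:C).
Proof.
have e0 : 2 * cis a != 0 :> R[i] by rewrite mulf_neq0 ?pnatr_eq0// cexp_neq0.
have cE : cis a = (cos a)%:C + 'i%C * (sin a)%:C.
  by rewrite cisE; simpc.
have i2 : 'i%C * 'i%C = -1 :> R[i] by rewrite -expr2 sqr_i.
have cs : (cos a)%:C * (cos a)%:C = 1 - (sin a)%:C * (sin a)%:C :> R[i].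
  rewrite -!expr2 -!rmorphXn cos2sin2 /= rmorphB rmorph1 //.
have h1 : 1 + cis (a *+ 2) = 2 * cis a * (cos a)%:C.
  rewrite cisMn expr2 cE.
  move: cs i2; move: ('i%C) ((cos a)%:C) ((sin a)%:C) => i c s cs i2.
  have -> : 1 + (c + i * s) * (c + i * s) = 1 + c * c + i * i * (s * s) + 2 * i * c * s by ring.
  have -> : 2 * (c + i * s) * c = c * c + c * c + 2 * i * c * s by ring.
  by rewrite i2 cs; ring.
have h2 : 1 - cis (a *+ 2) = 2 * cis a * (- ('i%C * (sin a)%:C)).
  rewrite cisMn expr2 cE.
  move: cs i2; move: ('i%C) ((cos a)%:C) ((sin a)%:C) => i c s cs i2.
  have -> : 1 - (c + i * s) * (c + i * s) = 1 - c * c - i * i * (s * s) - 2 * i * c * s by ring.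
  have -> : 2 * (c + i * s) * - (i * s) = - (i * i) * (s * s) - (i * i) * (s * s) - 2 * i * c * s by ring.
  by rewrite i2 cs; ring.
rewrite /cayley h1 h2 [k * _]mulrCA -mulrDr -mulf_div divff// mul1r.
by congr (_ / _); ring.
Qed.

(* [gfun b] is [(V - 1) (V - 3/2) / 2] with [V = (1 - (4 - 3i) x) / (1 - (4 + 3i) x)],
   [x = i b w]: on the real [x]-axis its real part is a trigonometric polynomial
   in [arg V] that is positive only for [1/8 < x < 8], with a double zero at
   [x = 0]. *)
Definition mob b v : R[i] := (- (6 * b))%:C * cayley ((3 * b) +i* (- (4 * b))) v.
Definition gfun b v : R[i] := 2^-1 * mob b v ^+ 2 - 4^-1 * mob b v.

Lemma disc_approx_gfun T (D : set T) b : 0 < b ->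
  disc_approx D (fun _ v => gfun b v).
Proof.
move=> b0; have mA : disc_approx D (fun _ v => mob b v).
  apply: disc_approxM; first exact: disc_approx_const.
  by apply: disc_approx_cayley => /=; rewrite mulr_gt0.
apply: disc_approxD.
  by apply: disc_approxM; [exact: disc_approx_const|exact: disc_approxX].
by apply: disc_approxN; apply: disc_approxM => //; exact: disc_approx_const.
Qed.

Lemma Re_gfunE b v p q : mob b v = (- p) +i* q ->
  complex.Re (gfun b v) = (p ^+ 2 - q ^+ 2) / 2 + p / 4.
Proof.
move=> e; rewrite /gfun e.
have -> : 2^-1 = (2^-1)%:C :> R[i] by rewrite fmorphV rmorph_nat.
have -> : 4^-1 = (4^-1)%:C :> R[i] by rewrite fmorphV rmorph_nat.
by rewrite !expr2; simpc; rewrite /=; lra.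
Qed.

(** The linear part of [gfun] contributes [p / 4], about [3 b / 2], and the quadratic part is
    nonnegative because [|q| <= p]. The cap on [b] absorbs the higher-order loss. This growth,
    linear in [b], is what makes [|G (i y)|] large. *)
Lemma Re_gfun0_ge b : 0 < b <= 1 / 100 -> b <= complex.Re (gfun b 0).
Proof.
move=> /andP[b0 b1]; pose d := (1 + 3 * b) ^+ 2 + (4 * b) ^+ 2.
have d0 : 0 < d by rewrite /d !expr2; nra.
pose p := 6 * b * (1 + 3 * b) / d; pose q := - (24 * b ^+ 2 / d).
rewrite (@Re_gfunE _ _ p q); last first.
  have k0 : 1 + ((3 * b) +i* (- (4 * b))) != 0 :> R[i].
    by rewrite eq_complex /= negb_and gt_eqF//=; lra.
  rewrite /mob cayley0; apply: (mulIf k0); rewrite divfK//.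
  rewrite [1 + _](_ : _ = (1 + 3 * b) +i* (- (4 * b))); last by simpc.
  simpc; apply/eqP; rewrite eq_complex /= /p /q.
  by apply/andP; split; apply/eqP; rewrite /d; field; rewrite -/d gt_eqF.
have p0 : b <= p / 4.
  by rewrite /p ler_pdivlMr// ler_pdivlMr// /d !expr2; nra.
have pq : 0 <= p + q.
  by rewrite /p /q -mulrBl divr_ge0 ?(ltW d0)// expr2; nra.
have pq' : 0 <= p - q.
  by rewrite /p /q opprK -mulrDl divr_ge0 ?(ltW d0)// expr2; nra.
rewrite subr_sqr; have := mulr_ge0 pq pq'; lra.
Qed.

Let quad_gt0 (x : R) : 0 < 1 - 8 * x + 25 * x ^+ 2.
Proof. by have := sqr_ge0 (x - 4 / 25); rewrite !expr2; lra. Qed.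

(** On the unit circle the argument of [gfun] is the real number [x = - b cot a]. The formula shows
    the sign: for [x] nonzero it is that of [8 x - 1 - x^2], whose roots [4 +- sqrt 15] lie between
    1/8 and 8. *)
Lemma Re_gfun_cis b a (x := - (b * cos a / sin a)) : 0 < b -> sin a != 0 ->
  complex.Re (gfun b (cis (a *+ 2))) =
    27 / 2 * x ^+ 2 * (8 * x - 1 - x ^+ 2) / (1 - 8 * x + 25 * x ^+ 2) ^+ 2.
Proof.
move=> b0 s0; pose d := 1 - 8 * x + 25 * x ^+ 2.
have d0 : 0 < d := quad_gt0 x.
rewrite (@Re_gfunE _ _ (18 * x ^+ 2 / d) (6 * x * (1 - 4 * x) / d)).
  by rewrite -/d /d; field; rewrite -/d gt_eqF.
have bc : b * cos a = - x * sin a by rewrite opprK divfK.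
clearbody x.
have den0 : ((3 * b) +i* (- (4 * b))) * (cos a)%:C - 'i%C * (sin a)%:C != 0.
  simpc; rewrite eq_complex /= negb_and -!mulrA bc.
  have [xs|xs] := eqVneq (3 * (- x * sin a)) 0; last by [].
  have : x * sin a == 0 by apply/eqP; lra.
  rewrite mulf_eq0 (negPf s0) orbF => /eqP ->.
  by rewrite /= !(mul0r, oppr0, mulr0, add0r, sub0r) oppr_eq0.
rewrite /mob cayley_cis mulrA; apply: (mulIf den0); rewrite divfK//.
simpc; apply/eqP; rewrite eq_complex /= -!mulrA bc.
by apply/andP; split; apply/eqP; rewrite /d; field; rewrite -/d gt_eqF.
Qed.

Lemma Re_gfun_cis_le b a : 0 < b -> sin a != 0 ->
  complex.Re (gfun b (cis (a *+ 2))) <= 5 / 2.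
Proof.
move=> b0 s0; rewrite Re_gfun_cis//; move: (- _) => x.
have d0 := quad_gt0 x.
rewrite ler_pdivrMr ?exprn_gt0//.
(* As [8 x - 1 - x^2 = 24 x^2 - d], the claim is the nonnegativity of a quadratic form in [d] and
   [x^2]. It factors, one factor being [2 (1 - 4 x)^2]; the value 5/2 is attained at [x = 1/4]. *)
move: d0; set d := 1 - _ + _ => d0.
have hp : 0 <= 2 * d - 18 * x ^+ 2.
  rewrite [leRHS](_ : _ = 2 * (1 - 4 * x) ^+ 2); first by rewrite mulr_ge0 ?sqr_ge0.
  by rewrite /d; ring.
have hq : 0 <= 18 * x ^+ 2 + 5 / 4 * d by have := sqr_ge0 x; lra.
rewrite -subr_ge0; apply: le_trans (mulr_ge0 hp hq) _.
by rewrite le_eqVlt; apply/orP; left; apply/eqP; rewrite /d; field.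
Qed.

Lemma Re_gfun_cis_le0 b a : 0 < b -> sin a != 0 ->
  ~~ (1 / 8 < - (b * cos a / sin a) < 8) ->
  complex.Re (gfun b (cis (a *+ 2))) <= 0.
Proof.
move=> b0 s0; rewrite Re_gfun_cis//; move: (- _) => x xP.
rewrite pmulr_lle0 ?invr_gt0 ?exprn_gt0//.
apply: mulr_ge0_le0; first by rewrite pmulr_rge0 ?sqr_ge0.
move: xP; rewrite negb_and -!leNgt => /orP[x8|x8]; have := sqr_ge0 x.
  by lra.
by rewrite expr2; nra.
Qed.

(** With [z = i y w] for the Cayley image [w] of [v], this is [i z / (1 - e i z)], a bounded
    substitute for the unbounded [i z]. On the circle [z] is real and the substitute keeps a
    nonpositive real part; at the centre [i z = - y]. *)
Definition izeps y e v : R[i] := (- y)%:C * cayley (e * y)%:C v.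

Lemma disc_approx_izeps T (D : set T) y e : 0 < y -> 0 < e ->
  disc_approx D (fun _ v => izeps y e v).
Proof.
move=> y0 e0; apply: disc_approxM; first exact: disc_approx_const.
by apply: disc_approx_cayley; rewrite /= mulr_gt0.
Qed.

Lemma izeps0 y e : 0 < y -> 0 < e -> izeps y e 0 = (- (y / (1 + e * y)))%:C.
Proof.
move=> y0 e0; rewrite /izeps cayley0 -(rmorph1 (@real_complex_def R (Phant R))) -rmorphD -fmorphV -rmorphM.
by rewrite mulNr.
Qed.

Lemma izeps_cis y e a (u := - (y * cos a / sin a)) : sin a != 0 ->
  izeps y e (cis (a *+ 2)) =
    (- (e * u ^+ 2 / (1 + e ^+ 2 * u ^+ 2))) +i* (u / (1 + e ^+ 2 * u ^+ 2)).
Proof.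
move=> s0; have d0 : 0 < 1 + e ^+ 2 * u ^+ 2.
  by rewrite ltr_pwDl// mulr_ge0 ?sqr_ge0.
have yc : y * cos a = - u * sin a by rewrite opprK divfK.
clearbody u.
have den0 : (e * y)%:C * (cos a)%:C - 'i%C * (sin a)%:C != 0 :> R[i].
  by simpc; rewrite eq_complex /= negb_and oppr_eq0 s0 orbT.
rewrite /izeps cayley_cis mulrA; apply: (mulIf den0); rewrite divfK//.
simpc; apply/eqP; rewrite eq_complex /= -!mulrA !(mulNr, yc).
apply/andP; split; apply/eqP; field; by rewrite gt_eqF// mulrA -expr2.
Qed.

Lemma Re_izeps_cis_le0 y e a : 0 < e -> sin a != 0 ->
  complex.Re (izeps y e (cis (a *+ 2))) <= 0.
Proof.
move=> e0 s0; rewrite izeps_cis//= oppr_le0 divr_ge0//.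
  by rewrite mulr_ge0 ?sqr_ge0// ltW.
by rewrite addr_ge0// mulr_ge0 ?sqr_ge0.
Qed.

Lemma izeps_cis_approx y e a (u := - (y * cos a / sin a)) : 0 < e -> sin a != 0 ->
  normc (izeps y e (cis (a *+ 2)) - 0 +i* u) <= e * u ^+ 2 * 2.
Proof.
move=> e0 s0; rewrite izeps_cis// -/u; clearbody u.
have d1 : 1 <= 1 + e ^+ 2 * u ^+ 2 by rewrite lerDl mulr_ge0 ?sqr_ge0.
have d0 : 0 < 1 + e ^+ 2 * u ^+ 2 by rewrite (lt_le_trans ltr01).
have eu0 : 0 <= e * u ^+ 2 by rewrite mulr_ge0 ?sqr_ge0// ltW.
rewrite (le_trans (normc_le_ReIm _))//= subr0 mulr2n mulrDr !mulr1 lerD//.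
  by rewrite normrN ger0_norm ?divr_ge0 ?(ltW d0)// ler_pdivrMr// ler_peMr.
rewrite [X in `|X|](_ : _ = - (u * (e ^+ 2 * u ^+ 2) / (1 + e ^+ 2 * u ^+ 2))); last first.
  by field; rewrite exprMn lt0r_neq0.
rewrite normrN normrM normfV (ger0_norm (ltW d0)) ler_pdivrMr// normrM.
rewrite (@ger0_norm _ (e ^+ 2 * _)); last by rewrite -exprMn sqr_ge0.
have -> : u ^+ 2 = `|u| ^+ 2 by rewrite real_normK ?num_real.
have w0 := normr_ge0 u; move: w0; move: `|u| => w w0.
rewrite -subr_ge0 [leRHS](_ : _ = e * w ^+ 2 * (1 + (e * w) ^+ 2 - e * w)); last by ring.
apply: mulr_ge0; first by rewrite mulr_ge0 ?sqr_ge0// ltW.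
by have := sqr_ge0 (e * w - 1 / 2); rewrite !expr2; lra.
Qed.

End HalfPlane.

(** * Spacing of the boundary points that correspond to the nodes *)

Section NodeSpacing.
Context {R : realType}.

(** Induction removes the last point. If it is counted, the earlier ones lie in [[a, s m - d]],
    which is shorter by at least [d], or none of them is counted. *)
Lemma count_separated (s : nat -> R) (d a b : R) m : 0 < d -> a <= b ->
  (forall i j, (i < j < m)%N -> s i + d <= s j) ->
  (\sum_(j < m | a <= s j <= b) 1) * d <= b - a + d.
Proof.
move=> d0; elim: m b => [|m ih] b ab sep.
  by rewrite big_ord0 mul0r addr_ge0 ?subr_ge0// ltW.
have sep' i j : (i < j < m)%N -> s i + d <= s j.
  by move=> /andP[ij jm]; rewrite sep// ij ltnW.
rewrite big_mkcond big_ord_recr/= -big_mkcond/=.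
case: ifPn => [/andP[am mb]|_]; last by rewrite addr0 ih.
rewrite mulrDl mul1r.
have [am'|am'] := leP a (s m - d).
  have h : \sum_(j < m | a <= s j <= b) 1 <= \sum_(j < m | a <= s j <= s m - d) 1 :> R.
    rewrite big_mkcond [leRHS]big_mkcond/=; apply: ler_sum => j _.
    have := sep j m; rewrite ltn_ord ltnSn => /(_ isT) jm.
    by case: ifPn => [/andP[-> _]|_]; [rewrite lerBrDr jm|case: ifP].
  have := ih _ am' sep'; have := ler_wpM2r (ltW d0) h.
  lra.
rewrite big_pred0 ?mul0r; first lra.
move=> j; apply/negbTE; rewrite negb_and -!ltNge; apply/orP; left.
have := sep j m; rewrite ltn_ord ltnSn => /(_ isT); lra.
Qed.

(** The real point to which the conformal map of the disc onto the upper half-plane that takes 0 to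
    [i y] sends the [j]-th node. *)
Definition abscissa (y : R) m j : R :=
  - (y * cos (half_angle m j) / sin (half_angle m j)).

Lemma sin_half_angle_gt0 m j : (j < m)%N -> 0 < sin (half_angle m j) :> R.
Proof. by move=> jm; apply: sin_gt0_pi; exact: half_angle_itv. Qed.

Lemma sin_ge_half (x : R) : 0 <= x <= 1 / 2 -> x / 2 <= sin x.
Proof.
move=> /andP[x0 x1]; have := @normr_sin_taylor_le R x.
rewrite ger0_norm// => h; have {h} : `|sin x - x| <= x ^+ 2 by apply: h; lra.
by rewrite ler_norml expr2 => /andP[h _]; nra.
Qed.

(** Consecutive cotangents differ by [sin (pi / m)] over a product of two sines, hence by at least
    [sin (pi / m)]. For [m >= 8] the angle is at most 1/2, and there [sin x >= x / 2], which gives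
    [1 / m]. *)
Lemma abscissa_sep (y : R) m i j : 0 < y -> (8 <= m)%N -> (i < j < m)%N ->
  abscissa y m i + y / m%:R <= abscissa y m j.
Proof.
move=> y0 m8; have m0 : 0 < m%:R :> R by rewrite ltr0n (leq_trans _ m8).
have step k : (k.+1 < m)%N -> abscissa y m k + y / m%:R <= abscissa y m k.+1.
  move=> km; rewrite /abscissa.
  have sa := sin_half_angle_gt0 (ltnW km); have sb := sin_half_angle_gt0 km.
  have ab : half_angle m k.+1 - half_angle m k = pi / m%:R :> R.
    have oddE l : (l.*2.+1)%:R = 2 * l%:R + 1 :> R.
      by rewrite -addn1 natrD -mul2n natrM.
    have m2 : (m.*2)%:R = 2 * m%:R :> R by rewrite -mul2n natrM.
    have kE : k.+1%:R = k%:R + 1 :> R by rewrite natr1.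
    rewrite /half_angle !oddE m2 kE.
    by field; rewrite gt_eqF.
  have sin_ge : m%:R^-1 <= sin (pi / m%:R) :> R.
    apply: le_trans (sin_ge_half _).
      by rewrite mulrAC -[leLHS]mul1r ler_wpM2r ?invr_ge0 ?(ltW m0)// ler_pdivlMr// mul1r pi_ge2.
    rewrite divr_ge0 ?pi_ge0//= ler_pdivrMr//.
    have := @pihalf_lt2 R; have : (8 : R) <= m%:R by rewrite ler_nat.
    by lra.
  have := sinB (half_angle m k.+1) (half_angle m k : R); rewrite ab.
  move: sin_ge sa sb (sin_le1 (half_angle m k : R)) (sin_le1 (half_angle m k.+1 : R)).
  move: (sin (pi / m%:R)) (sin (half_angle m k)) (cos (half_angle m k))
    (sin (half_angle m k.+1)) (cos (half_angle m k.+1)) => S s c t d Sm s0 t0 s1 t1 e.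
  rewrite -subr_ge0 [leRHS](_ : _ = y * (S / (s * t) - m%:R^-1)); last first.
    by rewrite e; field; rewrite !gt_eqF.
  rewrite pmulr_rge0// subr_ge0 (le_trans Sm)// ler_pdivlMr ?mulr_gt0//.
  have S0 : 0 <= S by rewrite (le_trans _ Sm)// invr_ge0 ltW.
  by rewrite ler_piMr// mulr_ile1// ltW.
elim: j => [//|j ih] /andP[]; rewrite ltnS leq_eqVlt => /predU1P[->|ij] jm.
  exact: step.
have := ih; rewrite ij (ltnW jm) => /(_ isT) h; apply: (le_trans h).
apply: le_trans (step _ jm); rewrite lerDl divr_ge0// ltW//.
Qed.

End NodeSpacing.

(** * The logarithmic series *)

Section LogSeries.
Context {R : realType}.

Local Notation lnn n := (ln (n%:R : R)).

Lemma lnn_gt0 n : (2 <= n)%N -> 0 < lnn n.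
Proof. by move=> n2; rewrite ln_gt0// ltr1n. Qed.

Lemma lnn_le m n : (1 <= m)%N -> (m <= n)%N -> lnn m <= lnn n.
Proof. by move=> m1 mn; rewrite ler_ln ?posrE ?ltr0n ?ler_nat// (leq_trans m1). Qed.

Lemma lnnS_sub_le n : (1 <= n)%N -> lnn n.+1 - lnn n <= n%:R^-1.
Proof.
move=> n1; have n0 : 0 < n%:R :> R by rewrite ltr0n.
rewrite -ln_div ?posrE ?ltr0n//.
have -> : n.+1%:R / n%:R = 1 + n%:R^-1 :> R.
  by rewrite -natr1 mulrDl divff ?gt_eqF// div1r.
by apply: le_ln1Dx; rewrite (lt_trans _ (_ : 0 < n%:R^-1)) ?invr_gt0//; lra.
Qed.

Lemma lnnS_sub_ge n : (1 <= n)%N -> n.+1%:R^-1 <= lnn n.+1 - lnn n.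
Proof.
move=> n1; have n0 : 0 < n%:R :> R by rewrite ltr0n.
have n10 : 0 < n.+1%:R :> R by rewrite ltr0n.
rewrite -opprB lerNr -ln_div ?posrE//.
have -> : n%:R / n.+1%:R = 1 + (- n.+1%:R^-1) :> R.
  by rewrite -[X in X / _](addrK 1) natr1 mulrBl divff ?gt_eqF// div1r.
apply: le_ln1Dx; rewrite ltrN2 invf_lt1// ltr1n//.
Qed.

Lemma ln2_ge_half : 1 / 2 <= lnn 2.
Proof. by have := @lnnS_sub_ge 1 isT; rewrite ln1 subr0 div1r. Qed.

(** The weight is compared with a telescoping difference of [1 / log], since [log] grows from [n] to
    [n.+1] by at least [1 / n.+1]; the bound in the other direction uses growth at most [1 / n]. *)
Lemma log_weight_le n : (2 <= n)%N ->
  (n.+1%:R * lnn n.+1 ^+ 2)^-1 <= (lnn n)^-1 - (lnn n.+1)^-1.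
Proof.
move=> n2; have a0 := lnn_gt0 n2; have b0 := lnn_gt0 (leqW n2).
have n0 : 0 < n.+1%:R :> R by rewrite ltr0n.
have := lnnS_sub_ge (ltnW n2); have := lnn_le (ltnW n2) (leqnSn n).
move: a0 b0; move: (lnn n) (lnn n.+1) => a b a0 b0 ab h.
have -> : a^-1 - b^-1 = (b - a) / (a * b) by field; rewrite !gt_eqF.
rewrite invfM ler_pM ?invr_ge0 ?sqr_ge0 ?(ltW n0)//.
by rewrite lef_pV2 ?posrE ?exprn_gt0 ?mulr_gt0// expr2 ler_pM2r.
Qed.

Lemma log_weight_ge n : (2 <= n)%N ->
  (lnn n)^-1 - (lnn n.+1)^-1 <= (n%:R * lnn n ^+ 2)^-1.
Proof.
move=> n2; have a0 := lnn_gt0 n2; have b0 := lnn_gt0 (leqW n2).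
have n0 : 0 < n%:R :> R by rewrite ltr0n ltnW.
have := lnnS_sub_le (ltnW n2); have := lnn_le (ltnW n2) (leqnSn n).
move: a0 b0; move: (lnn n) (lnn n.+1) => a b a0 b0 ab h.
have -> : a^-1 - b^-1 = (b - a) / (a * b) by field; rewrite !gt_eqF.
rewrite [leRHS]invfM ler_pM ?subr_ge0 ?invr_ge0 ?mulr_ge0 ?(ltW a0) ?(ltW b0)//.
by rewrite lef_pV2 ?posrE ?exprn_gt0 ?mulr_gt0// expr2 ler_pM2l.
Qed.

Lemma sum_log_weight_le a b : (2 <= a)%N -> (a <= b)%N ->
  \sum_(a <= n < b) (n%:R * lnn n ^+ 2)^-1 <= 2 / lnn a.
Proof.
move=> a2; case: b => [|b]; first by rewrite leqn0 => /eqP a0; rewrite a0 in a2.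
have a0 := lnn_gt0 a2.
rewrite leq_eqVlt => /predU1P[<-|]; first by rewrite big_geq// divr_ge0// ltW.
(* The induction carries a stronger bound: the first term is at most [1 / lnn a] because
   [a * lnn a >= 1], and the later ones telescope. *)
rewrite ltnS => ab; apply: (@le_trans _ _ (2 / lnn a - (lnn b)^-1)); last first.
  by rewrite gerBl invr_ge0 ltW// lnn_gt0// (leq_trans a2).
elim: b ab => [|b ih]; first by rewrite leqn0 => /eqP a0'; rewrite a0' in a2.
rewrite leq_eqVlt => /predU1P[<-|].
  rewrite big_nat1 mulrDl mul1r addrK invfM expr2 invfM mulrA ler_piMl ?invr_ge0 ?(ltW a0)//.
  rewrite -invfM invf_le1 ?mulr_gt0 ?ltr0n ?(leq_trans _ a2)//.
  have := le_trans ln2_ge_half (lnn_le (isT : (1 <= 2)%N) a2).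
  have : (2 : R) <= a%:R by rewrite ler_nat.
  by nra.
rewrite ltnS => ab; rewrite big_nat_recr ?leqW//=.
rewrite (le_trans (lerD (ih ab) (log_weight_le (leq_trans a2 ab))))//.
by rewrite addrA subrK.
Qed.

Lemma sum_log_weight_ge a b : (2 <= a)%N -> (a <= b)%N ->
  (lnn a)^-1 - (lnn b)^-1 <= \sum_(a <= n < b) (n%:R * lnn n ^+ 2)^-1.
Proof.
move=> a2; elim: b => [|b ih]; first by rewrite leqn0 => /eqP a0; rewrite a0 in a2.
rewrite leq_eqVlt => /predU1P[<-|]; first by rewrite subrr big_geq.
rewrite ltnS => ab; rewrite big_nat_recr//=.
by rewrite -(subrKA (lnn b)^-1) lerD ?ih ?log_weight_ge// (leq_trans a2).
Qed.

(** The logarithms form a geometric progression of ratio [B], which is the natural block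
    decomposition for a series in [log n]. *)
Definition tower (B k : nat) := (2 ^ (B ^ k))%N.

Lemma tower_ge2 B k : (0 < B)%N -> (2 <= tower B k)%N.
Proof. by move=> B0; rewrite -{1}(expn1 2) leq_pexp2l// expn_gt0 B0. Qed.

Lemma leq_tower B k l : (0 < B)%N -> (k <= l)%N -> (tower B k <= tower B l)%N.
Proof. by move=> B0 kl; rewrite leq_pexp2l// leq_pexp2l. Qed.

Lemma ltn_tower B k : (1 < B)%N -> (k < tower B k)%N.
Proof.
move=> B1; apply: (@ltn_trans (B ^ k)); first exact: ltn_expl.
exact: ltn_expl.
Qed.

Lemma ln_tower B k : lnn (tower B k) = B%:R ^+ k * ln 2.
Proof. by rewrite /tower natrX lnXn// -[_ *+ (B ^ k)]mulr_natl natrX. Qed.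

Lemma ln_towerS B k : lnn (tower B k.+1) = B%:R * lnn (tower B k).
Proof. by rewrite !ln_tower exprS mulrA. Qed.

Variable Phi : nat -> R.
Hypothesis Phi_gt0 : forall n, (2 <= n)%N -> 0 < Phi n.
Hypothesis Phi_incr : forall m n, (2 <= m)%N -> (m <= n)%N -> Phi m <= Phi n.

(** The positive part is taken because [Phi] may be below 1. *)
Definition log_ratio B k : R :=
  Num.max 0 (ln (Phi (tower B k))) / lnn (tower B k).

Lemma log_ratio_ge0 B k : (0 < B)%N -> 0 <= log_ratio B k.
Proof.
by move=> B0; rewrite divr_ge0 ?le_max ?lexx// ltW// lnn_gt0// tower_ge2.
Qed.

(** On each block monotonicity bounds [Phi] by its value at the right end, while the weights sum to
    at most 2 over the logarithm of the left end; the factor [B] turns this into the logarithm of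
    the right end. *)
Lemma sum_log_block_le B k K : (1 < B)%N -> (k <= K)%N ->
  \sum_(tower B k <= n < tower B K) ln (Phi n) / (n%:R * lnn n ^+ 2) <=
  2 * B%:R * \sum_(k <= l < K) log_ratio B l.+1.
Proof.
move=> B1; have B0 := ltnW B1.
elim: K => [|K ih]; first by rewrite leqn0 => /eqP ->; rewrite !big_geq// mulr0.
rewrite leq_eqVlt => /predU1P[<-|]; first by rewrite !big_geq// mulr0.
rewrite ltnS => kK; rewrite (big_cat_nat _ (n := tower B K)) ?leq_tower//=.
rewrite [X in _ <= _ * X]big_nat_recr//= mulrDr lerD ?ih//.
have T2 := tower_ge2 K B0.
apply: (@le_trans _ _ (Num.max 0 (ln (Phi (tower B K.+1))) *
   \sum_(tower B K <= n < tower B K.+1) (n%:R * lnn n ^+ 2)^-1)).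
  rewrite mulr_sumr; apply: ler_sum_nat => n /andP[n1 n2].
  have n3 := leq_trans T2 n1.
  apply: ler_wpM2r.
    by rewrite invr_ge0 mulr_ge0 ?sqr_ge0.
  rewrite le_max ler_ln ?posrE ?Phi_gt0 ?Phi_incr ?orbT ?tower_ge2//.
  exact: ltnW.
rewrite mulrC (le_trans (ler_wpM2r _ (sum_log_weight_le T2 _))) ?le_max ?lexx ?leq_tower//.
rewrite /log_ratio ln_towerS.
have := lnn_gt0 T2; move: (lnn _) (Num.max _ _) => u M u0.
have B0R : (0 : R) < B%:R by rewrite ltr0n.
by rewrite le_eqVlt; apply/orP; left; apply/eqP; field; rewrite !gt_eqF.
Qed.

(** The cap at 1 does not destroy divergence. If the ratios are eventually at most 1 it is inactive
    and the block bound applies; otherwise infinitely many terms equal 1. *)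
Lemma min_log_ratio_diverges B (k0 : nat) (M : R) : (1 < B)%N ->
  (fun N : nat => \sum_(2 <= n < N) ln (Phi n) / (n%:R * lnn n ^+ 2)) @ \oo --> +oo ->
  exists2 K, (k0 <= K)%N & M <= \sum_(k0 <= k < K) Num.min 1 (log_ratio B k).
Proof.
move=> B1 div; have B0 := ltnW B1.
have pos k : 0 <= Num.min 1 (log_ratio B k) by rewrite le_min ler01 log_ratio_ge0.
have [[k1 k1P]|H] := pselect (exists k1, forall k, (k1 <= k)%N -> log_ratio B k <= 1).
  pose k2 := maxn k0 k1.
  pose C := \sum_(2 <= n < tower B k2) ln (Phi n) / (n%:R * lnn n ^+ 2).
  have /cvgryPge /(_ (C + 2 * B%:R * M)) [N _ NP] := div.
  pose K := (maxn N k2).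
  have NK : (N <= tower B K)%N.
    by rewrite (leq_trans (leq_maxl N k2))// ltnW// ltn_tower.
  exists K.+1; first by rewrite leqW// leq_max leq_maxl orbT.
  have kK : (k2 <= K)%N by rewrite leq_maxr.
  have := NP _ NK; rewrite /= (big_cat_nat _ (n := tower B k2)) ?tower_ge2 ?leq_tower//=.
  rewrite lerD2l => h.
  have BR : (0 : R) < 2 * B%:R by rewrite mulr_gt0 ?ltr0n.
  have := le_trans h (sum_log_block_le B1 kK); rewrite ler_pM2l// => /le_trans; apply.
  rewrite [leRHS](big_cat_nat _ (n := k2.+1)) ?ltnS ?leqW ?leq_maxl//=.
  rewrite -[leLHS]add0r lerD ?sumr_ge0// big_add1/=.
  apply: ler_sum_nat => k /andP[kk _]; rewrite le_min lexx andbT.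
  by apply: k1P; rewrite (leq_trans _ (leqW kk))// leq_maxr.
have ones n : exists2 K, (k0 <= K)%N & n%:R <= \sum_(k0 <= k < K) Num.min 1 (log_ratio B k).
  elim: n => [|n [K kK h]]; first by exists k0; rewrite ?big_geq.
  have [k Kk xk] : exists2 k, (K <= k)%N & 1 < log_ratio B k.
    apply: contrapT => H'; apply: H; exists K => k Kk; rewrite leNgt; apply/negP => xk.
    by apply: H'; exists k.
  exists k.+1; first by rewrite leqW// (leq_trans kK).
  rewrite big_nat_recr ?(leq_trans kK)//= (min_l (ltW xk)) -natr1 lerD2r.
  rewrite (le_trans h)// (big_cat_nat _ (n := K) (p := k))//=.
  by rewrite lerDl sumr_ge0.
have [K kK h] := ones (Num.trunc M).+1; exists K => //.
by rewrite (le_trans _ h)// ltW// truncnS_gt.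
Qed.

End LogSeries.

(** * The outer function built from scaled copies of [gfun] *)

Section Approximants.
Context {R : realType}.
Variable Phi : nat -> R.
Hypothesis Phi_gt0 : forall n, (2 <= n)%N -> 0 < Phi n.
Hypothesis Phi_incr : forall m n, (2 <= m)%N -> (m <= n)%N -> Phi m <= Phi n.

Local Notation lnn n := (ln (n%:R : R)).
Local Notation U k := (lnn (tower 64 k)).

Lemma natcpowE n (t : R) : (1 <= n)%N ->
  natcpow n ('i%C * t%:C - 1) = n%:R^-1 * cis (t * lnn n).
Proof.
move=> n1; have n0 : 0 < n%:R :> R by rewrite ltr0n.
rewrite /natcpow natr_realc mulrBl mul1r addrC cexpD.
rewrite -rmorphN cexp_real expRN lnK ?posrE// fmorphV; congr (_ * _).
by rewrite /cis; congr cexp; simpc.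
Qed.

(* The scale [y / (8 * U k)] makes [Re (gfun _)] positive only at abscissae
   between [U k] and [U k.+1]; [5 / 2] bounds it there. *)
Definition weight k : R := 2 / 5 * (U k * Num.min 1 (log_ratio Phi 64 k)).
Definition qfun (y : R) k0 K v : R[i] :=
  \sum_(k0 <= k < K) (weight k)%:C * gfun (y / (8 * U k)) v.

Let U_gt0 k : 0 < U k. Proof. by rewrite lnn_gt0// tower_ge2. Qed.

Lemma weight_ge0 k : 0 <= weight k.
Proof.
rewrite mulr_ge0// mulr_ge0 ?(ltW (U_gt0 k))// le_min ler01.
exact: log_ratio_ge0.
Qed.

Lemma Re_qfun y k0 K v : complex.Re (qfun y k0 K v) =
  \sum_(k0 <= k < K) weight k * complex.Re (gfun (y / (8 * U k)) v).
Proof.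
rewrite /qfun; elim/big_ind2 : _ => // [a b c d <- <-|k _].
  by rewrite -(raddfD (@complex.Re R : {additive R[i] -> R})).
by case: (gfun _ _) => a b; simpc.
Qed.

Lemma disc_approx_qfun T (D : set T) y k0 K : 0 < y ->
  disc_approx D (fun _ v => qfun y k0 K v).
Proof.
move=> y0; apply: disc_approx_sum => k.
apply: disc_approxM; first exact: disc_approx_const.
by apply: disc_approx_gfun; rewrite divr_gt0// mulr_gt0.
Qed.

(** The scale [U k] cancels between the weight and the bound [y / (8 U k)] for one bump at the
    centre, leaving [y / 20] times the capped ratio. The condition on [k0] puts every scale below
    1/100. *)
Lemma Re_qfun0_ge y k0 K : 0 < y -> 100 * y <= 8 * U k0 ->
  y / 20 * \sum_(k0 <= k < K) Num.min 1 (log_ratio Phi 64 k) <=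
    complex.Re (qfun y k0 K 0).
Proof.
move=> y0 yk; rewrite Re_qfun mulr_sumr; apply: ler_sum_nat => k /andP[kk _].
have u0 := U_gt0 k.
have uk : U k0 <= U k by rewrite lnn_le ?leq_tower// ltnW// tower_ge2.
apply: (@le_trans _ _ (weight k * (y / (8 * U k)))).
  by rewrite le_eqVlt; apply/orP; left; apply/eqP; rewrite /weight; field; rewrite gt_eqF.
apply: ler_wpM2l; first exact: weight_ge0.
apply: Re_gfun0_ge; rewrite divr_gt0 ?mulr_gt0//= ler_pdivrMr ?mulr_gt0//.
lra.
Qed.

(** The ratio of 8 to 1/8 is 64, the base of the tower, so the intervals of positivity for distinct
    [k] do not overlap. *)
Lemma Re_gfun_node_le0 y k m j : 0 < y -> (j < m)%N ->
  ~~ (U k < abscissa y m j < U k.+1) ->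
  complex.Re (gfun (y / (8 * U k)) (node m j)) <= 0.
Proof.
move=> y0 jm h; have u0 := U_gt0 k.
have s0 : sin (half_angle m j) != 0 :> R by rewrite gt_eqF// sin_half_angle_gt0.
apply: Re_gfun_cis_le0 => //; first by rewrite divr_gt0 ?mulr_gt0.
have -> : - (y / (8 * U k) * cos (half_angle m j) / sin (half_angle m j)) =
    abscissa y m j / (8 * U k).
  by rewrite /abscissa; move: (cos _) (sin _) s0 => c s s0; field; rewrite s0 gt_eqF.
have u8 : 0 < 8 * U k by rewrite mulr_gt0.
move: h; rewrite ln_towerS ltr_pdivlMr// ltr_pdivrMr//; congr (~~ (_ && _)).
  by congr (_ < _); field.
by rewrite mulrA -natrM.
Qed.

Lemma Re_qfun_node_le0 y k0 K m j : 0 < y -> (j < m)%N ->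
  (forall k, (k0 <= k < K)%N -> ~~ (U k < abscissa y m j < U k.+1)) ->
  complex.Re (qfun y k0 K (node m j)) <= 0.
Proof.
move=> y0 jm h; rewrite Re_qfun big_nat_cond sumr_le0// => k /[!andbT] kP.
by rewrite mulr_ge0_le0 ?weight_ge0// Re_gfun_node_le0// h.
Qed.

(** At most one bump is positive at a given abscissa. Its contribution is at most [U k] times the
    capped ratio, hence below both [U k] and the positive part of [ln (Phi (tower 64 k))];
    monotonicity passes from [tower 64 k] to [n]. *)
Lemma Re_qfun_node_le y k0 K m j n : 0 < y -> (j < m)%N -> (2 <= n)%N ->
  abscissa y m j < lnn n.+1 ->
  complex.Re (qfun y k0 K (node m j)) <= Num.min (Num.max 0 (ln (Phi n))) (lnn n).
Proof.
move=> y0 jm n2 un.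
have [[k [kP kU]]|H] := pselect (exists k, (k0 <= k < K)%N /\
    (U k < abscissa y m j < U k.+1)); last first.
  apply: (@le_trans _ _ 0); last first.
    by rewrite le_min le_max lexx/= ltW// lnn_gt0.
  apply: Re_qfun_node_le0 => // k kP; apply/negP => kU; apply: H.
  by exists k.
have /andP[kU1 kU2] := kU; have u0 := U_gt0 k.
have Uinc l l' : (l <= l')%N -> U l <= U l'.
  by move=> ll; rewrite lnn_le ?leq_tower// ltnW// tower_ge2.
rewrite Re_qfun (bigD1_seq k) ?mem_index_iota ?iota_uniq//=.
apply: (@le_trans _ _ (weight k * (5 / 2) + 0)).
  apply: lerD.
    rewrite ler_wpM2l ?weight_ge0// Re_gfun_cis_le ?divr_gt0 ?mulr_gt0//.
    by rewrite gt_eqF// sin_half_angle_gt0.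
  apply: sumr_le0 => l lk; rewrite mulr_ge0_le0 ?weight_ge0// Re_gfun_node_le0//.
  rewrite negb_and -!leNgt; apply/orP; move: lk; rewrite neq_ltn => /orP[lk|kl].
    by right; rewrite (le_trans _ (ltW kU1))// Uinc.
  by left; rewrite (le_trans (ltW kU2))// Uinc.
(* The logarithms give only [tower 64 k < n.+1]; integrality does the rest. *)
have nk : (tower 64 k <= n)%N.
  rewrite -ltnS; have := lt_trans kU1 un; rewrite ltr_ln ?posrE ?ltr0n ?ltr_nat//.
  by rewrite ltnW// tower_ge2.
rewrite addr0 /weight mulrAC -(mulrA (2 / 5)).
have -> : 2 / 5 * (5 / 2 * (U k * Num.min 1 (log_ratio Phi 64 k))) =
  U k * Num.min 1 (log_ratio Phi 64 k) by field.
rewrite le_min; apply/andP; split; last first.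
  apply: (@le_trans _ _ (U k)); last by rewrite lnn_le// ltnW// tower_ge2.
  by rewrite ger_pMr// ge_min lexx.
apply: (@le_trans _ _ (U k * log_ratio Phi 64 k)).
  by rewrite ler_pM2l// ge_min lexx orbT.
rewrite /log_ratio mulrC divfK ?gt_eqF// ge_max !le_max lexx/=.
by rewrite ler_ln ?posrE ?Phi_gt0 ?tower_ge2// Phi_incr ?orbT ?tower_ge2.
Qed.

End Approximants.

(** * Dirichlet approximation of a decaying exponential *)

Section ExponentialApproximation.
Context {R : realType}.
Variable Phi : nat -> R.
Hypothesis Phi_gt0 : forall n, (2 <= n)%N -> 0 < Phi n.
Hypothesis Phi_incr : forall m n, (2 <= m)%N -> (m <= n)%N -> Phi m <= Phi n.

Local Notation lnn n := (ln (n%:R : R)).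

Lemma expR_sub_le (a b : R) : a <= 0 -> b <= 0 -> `|expR a - expR b| <= `|a - b|.
Proof.
move=> a0 b0; have := @normc_cexp_sub_le R a%:C b%:C a0 b0.
by rewrite !cexp_real -!rmorphB !normc_real.
Qed.

Lemma exchange_fiber_sum (V : zmodType) (m N : nat) (f : nat -> nat)
    (F : nat -> nat -> V) :
  \sum_(2 <= n < N.+1) \sum_(j < m | f j == n) F n j =
  \sum_(j < m | (2 <= f j <= N)%N) F (f j) j.
Proof.
under eq_bigr do rewrite big_mkcond.
rewrite exchange_big/= [RHS]big_mkcond/=; apply: eq_bigr => j _.
rewrite -big_mkcond/=; under eq_bigl do rewrite eq_sym.
by rewrite big_nat1_eq ltnS.
Qed.

(** The index of the frequency [log n] to which the abscissa is rounded down. Values below 2 mean an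
    abscissa below [log 2], which has no frequency to be rounded to. *)
Definition bucket (y : R) m j : nat := Num.trunc (expR (abscissa y m j)).

Lemma bucketP y m j n : (1 <= n)%N -> bucket y m j = n ->
  lnn n <= abscissa y m j < lnn n.+1.
Proof.
move=> n1 bn; have := truncn_itv (expR_ge0 (abscissa y m j)).
rewrite -/(bucket y m j) bn => /andP[h1 h2].
have n0 : 0 < n%:R :> R by rewrite ltr0n.
rewrite -[abscissa y m j]expRK ler_ln ?posrE ?expR_gt0// h1.
by rewrite ltr_ln ?posrE ?expR_gt0// ltr0n.
Qed.

Lemma bucket_lt2 y m j : (bucket y m j < 2)%N -> abscissa y m j < lnn 2.
Proof.
move=> b2; rewrite -[abscissa y m j]expRK ltr_ln ?posrE ?expR_gt0//.
have /andP[_ /lt_le_trans] := truncn_itv (expR_ge0 (abscissa y m j)).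
by apply; rewrite ler_nat.
Qed.

(** The part of the discrete mean of [G] carried by the nodes rounded to [log n], divided by
    [G (i y)]. The factor [n] compensates the [1 / n] in [n^(it - 1)]. *)
Definition coeff (y : R) k0 K m n : R[i] :=
  (n%:R / m%:R / cexp (qfun Phi y k0 K 0)) *
    \sum_(j < m | bucket y m j == n) cexp (qfun Phi y k0 K (node m j)).

(** Each value of [|G|] in the bucket is at most [max 1 (Phi n) <= c * Phi n]. The abscissae are
    [y / m] apart in an interval of length at most [1 / n], so there are at most [m / (n y) + 1] of
    them; multiplying by [n / m <= 1] gives [1 / y + 1]. *)
Lemma normc_coeff_le y k0 K m n (c : R) : 0 < y -> (8 <= m)%N -> (2 <= n <= m)%N ->
  1 <= c * Phi 2 -> 1 <= c ->
  normc (coeff y k0 K m n) <=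
    (y^-1 + 1) * c * Phi n / expR (complex.Re (qfun Phi y k0 K 0)).
Proof.
move=> y0 m8 /andP[n2 nm] cPhi c1.
have c0 : 0 <= c by rewrite (le_trans ler01).
have n1 := ltnW n2; have n0 : 0 < n%:R :> R by rewrite ltr0n.
have m0 : 0 < m%:R :> R by rewrite ltr0n (leq_trans _ m8).
rewrite normcMe !normc_div !normc_nat normc_cexp [leLHS]mulrAC.
rewrite ler_pM2r ?invr_gt0 ?expR_gt0//.
pose cnt : R := \sum_(j < m | bucket y m j == n) 1.
have Gle : normc (\sum_(j < m | bucket y m j == n) cexp (qfun Phi y k0 K (node m j)))
    <= cnt * (c * Phi n).
  rewrite mulr_suml (le_trans (normc_sum _ _ _))//.
  apply: ler_sum => j /eqP bn; have /andP[u1 u2] := bucketP n1 bn.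
  rewrite normc_cexp mul1r.
  have := Re_qfun_node_le Phi_gt0 Phi_incr k0 K y0 (ltn_ord j) n2 u2.
  rewrite le_min => /andP[h _].
  apply: (@le_trans _ _ (expR (Num.max 0 (ln (Phi n))))); first by rewrite ler_expR.
  have Pn : Phi 2 <= Phi n by rewrite Phi_incr.
  have [l0|l0] := leP 0 (ln (Phi n)).
    by rewrite lnK ?posrE ?Phi_gt0// ler_peMl// ltW// Phi_gt0.
  by rewrite expR0 (le_trans cPhi)// ler_wpM2l.
have cntle : cnt * (y / m%:R) <= n%:R^-1 + y / m%:R.
  have d0 : 0 < y / m%:R by rewrite divr_gt0.
  have := count_separated d0 (lnn_le n1 (leqnSn n)) (fun i j => @abscissa_sep R y m i j y0 m8).
  move=> h; apply: le_trans (le_trans h _); last by rewrite lerD2r lnnS_sub_le.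
  rewrite ler_pM2r// /cnt big_mkcond [leRHS]big_mkcond/=; apply: ler_sum => j _.
  case: eqP => [bn|_]; last by case: ifP.
  by have /andP[-> /ltW ->] := bucketP n1 bn.
apply: (@le_trans _ _ (n%:R / m%:R * (cnt * (c * Phi n)))).
  by rewrite ler_wpM2l// divr_ge0// ltW.
rewrite [leLHS]mulrA -[leRHS]mulrA; apply: ler_wpM2r.
  by rewrite mulr_ge0// ltW// Phi_gt0.
have -> : n%:R / m%:R * cnt = n%:R / y * (cnt * (y / m%:R)).
  by field; rewrite !gt_eqF.
apply: (@le_trans _ _ (n%:R / y * (n%:R^-1 + y / m%:R))).
  by rewrite ler_wpM2l// divr_ge0// ltW.
rewrite [leLHS](_ : _ = y^-1 + n%:R / m%:R); last by field; rewrite !gt_eqF.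
by rewrite lerD2l ler_pdivrMr// mul1r ler_nat.
Qed.

Lemma exp_approx (H y eta : R) : 0 <= H -> 0 < y -> 0 < eta ->
  (fun N : nat => \sum_(2 <= n < N) ln (Phi n) / (n%:R * lnn n ^+ 2)) @ \oo --> +oo ->
  exists N (a : nat -> R[i]), [/\ (2 <= N)%N,
    forall n, (2 <= n <= N)%N -> normc (a n) <= eta * Phi n &
    forall t, 0 <= t <= H ->
      normc ((expR (- (y * t)))%:C -
             \sum_(2 <= n < N.+1) a n * natcpow n ('i%C * t%:C - 1)) <= eta].
Proof.
move=> H0 y0 eta0 div.
(* By monotonicity [max 1 (Phi n) <= c * Phi n] for all [n >= 2]. *)
pose c := Num.max 1 (Phi 2)^-1.
have c1 : 1 <= c by rewrite le_max lexx.
have cPhi : 1 <= c * Phi 2.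
  by rewrite -ler_pdivrMr ?Phi_gt0// div1r le_max lexx orbT.
have yi0 : 0 < y^-1 by rewrite invr_gt0.
(* The size demanded of [|G (i y)|]. The first summand makes the coefficients small; the second
   makes [2 + 2 H], the error 1 of the mean plus the error [1 + 2 H] of rounding, cost at most
   [eta / 2] after division. *)
pose L := ((y^-1 + 1) * c + 2 * (2 + 2 * H)) / eta.
have L0 : 0 < L by rewrite divr_gt0// addr_gt0 ?mulr_gt0//; lra.
pose k0 := Num.trunc (100 * y).
have yk0 : 100 * y <= 8 * lnn (tower 64 k0).
  have h := ltW (truncnS_gt (100 * y)).
  rewrite ln_tower (le_trans h)//.
  have : (k0.+1%:R : R) <= 64 ^+ k0 by rewrite -natrX ler_nat ltn_expl.
  have := @ln2_ge_half R; rewrite -/k0; move: (64 ^+ k0) => p l p1.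
  have p0 : 0 <= p by rewrite (le_trans _ p1).
  nra.
have [K kK MP] := min_log_ratio_diverges Phi_gt0 Phi_incr k0 (20 / y * L) (isT : (1 < 64)%N) div.
have := @Re_qfun0_ge _ Phi y k0 K y0 yk0.
set g := complex.Re (qfun Phi y k0 K 0) => gge.
have gL : L <= expR g.
  apply: le_trans (expR_ge1Dx _).
  have : y / 20 * (20 / y * L) <= g.
    by apply: le_trans gge; rewrite ler_wpM2l// divr_ge0// ltW.
  have -> : y / 20 * (20 / y * L) = L by field; rewrite gt_eqF.
  lra.
pose N := tower 64 K.
have N2 : (2 <= N)%N by rewrite tower_ge2.
have NR : 0 < N%:R :> R by rewrite ltr0n ltnW.
pose L2 := lnn N.+1 ^+ 2.
have L20 : 0 <= L2 by rewrite sqr_ge0.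
(* The first bound keeps the regularisation error at the nodes below [H] even after multiplication
   by [|G| <= n <= N]; the second keeps the change of the limit function below [eta / 2]. *)
pose e := Num.min (2 * (L2 + 1) * N%:R)^-1 (eta / (2 * (H + 1) * y ^+ 2)).
have e0 : 0 < e.
  rewrite lt_min invr_gt0 divr_gt0 ?mulr_gt0 ?exprn_gt0//; lra.
have e1 : e * (2 * L2 * N%:R) <= 1.
  have D0 : 0 < 2 * (L2 + 1) * N%:R by rewrite !mulr_gt0//; lra.
  apply: (@le_trans _ _ (e * (2 * (L2 + 1) * N%:R))).
    by rewrite ler_wpM2l ?(ltW e0)// ler_wpM2r ?(ltW NR)//; lra.
  by rewrite -ler_pdivlMr// div1r ge_min lexx.
have e2 : H * (e * y ^+ 2) <= eta / 2.
  have D0 : 0 < 2 * (H + 1) * y ^+ 2 by rewrite !mulr_gt0 ?exprn_gt0//; lra.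
  have : e * (2 * (H + 1) * y ^+ 2) <= eta.
    by rewrite -ler_pdivlMr// ge_min lexx orbT.
  have : 0 <= e * y ^+ 2 by rewrite mulr_ge0 ?sqr_ge0// ltW.
  lra.
clearbody e.
(* At a node of abscissa [u] this is close to [G u * exp (i t u)]; at 0 it is [G (i y)] times
   [exp (- y t / (1 + e y))]. *)
pose Psi (t : R) v := cexp (qfun Phi y k0 K v + t%:C * izeps y e v).
have PsiA : disc_approx `[0, H]%classic Psi.
  apply: disc_approx_cexp; apply: disc_approxD; first exact: disc_approx_qfun.
  apply: disc_approxM; last exact: disc_approx_izeps.
  apply: disc_approx_cst; exists H => // t; rewrite /= in_itv/= => /andP[t0 tH].
  by rewrite normc_real ger0_norm.
have [m0 m0P] := disc_approx_mean PsiA ltr01.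
(* Beyond [m0] for the mean value property, at least 8 for the separation of abscissae, and at least
   [N] for the coefficient bound. *)
pose m := maxn m0.+1 (maxn 8 N).
have m8 : (8 <= m)%N by rewrite !leq_max leqnn orbT.
have Nm : (N <= m)%N by rewrite !leq_max leqnn !orbT.
have mm0 : (m0 < m)%N by rewrite leq_maxl.
have mR : 0 < m%:R :> R by rewrite ltr0n (leq_trans _ m8).
clearbody m.
exists N, (coeff y k0 K m); split=> // [n /andP[n2 nN]|t tH].
  rewrite (le_trans (normc_coeff_le k0 K y0 m8 _ cPhi c1)) ?n2 ?(leq_trans nN)//.
  rewrite mulrAC ler_wpM2r ?(ltW (Phi_gt0 _))//.
  rewrite ler_pdivrMr ?expR_gt0// (@le_trans _ _ (eta * L))//.
    by rewrite /L [eta * _]mulrC divfK ?gt_eqF// lerDl mulr_ge0//; lra.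
  by rewrite ler_wpM2l// ltW.
have /andP[t0 t1] := tH.
pose psi := expR (- (y / (1 + e * y) * t)).
have h1 : `|expR (- (y * t)) - psi| <= eta / 2.
  have ey : 0 < 1 + e * y by rewrite ltr_pwDl// mulr_ge0// ltW.
  apply: (le_trans (expR_sub_le _ _)).
  - by rewrite oppr_le0 mulr_ge0// ltW.
  - by rewrite oppr_le0 mulr_ge0 ?divr_ge0// ltW.
  rewrite [X in `|X|](_ : _ = - (t * (e * y ^+ 2) / (1 + e * y))); last first.
    by field; rewrite gt_eqF.
  have e20 : 0 <= e * y ^+ 2 by rewrite mulr_ge0 ?sqr_ge0// ltW.
  rewrite normrN ger0_norm; last by rewrite divr_ge0 ?(ltW ey)// mulr_ge0.
  apply: le_trans e2; rewrite ler_pdivrMr//.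
  apply: (@le_trans _ _ (H * (e * y ^+ 2))); first by rewrite ler_wpM2r.
  by rewrite ler_peMr ?(mulr_ge0 H0)// lerDl mulr_ge0 ?(ltW e0) ?(ltW y0).
rewrite (le_trans (normc_B_trans psi%:C _ _))// (splitr eta) lerD//.
  by rewrite -rmorphB normc_real.
have := m0P m t mm0; rewrite /= in_itv/= => /(_ tH) h2.
pose G0 := cexp (qfun Phi y k0 K 0).
have PsiE : Psi t 0 = G0 * psi%:C.
  rewrite /Psi cexpD izeps0// -rmorphM cexp_real; congr (_ * (expR _)%:C).
  by rewrite mulrN mulrC.
pose G j := cexp (qfun Phi y k0 K (node m j)).
have sumE : \sum_(2 <= n < N.+1) coeff y k0 K m n * natcpow n ('i%C * t%:C - 1) =
  G0^-1 * (m%:R^-1 * \sum_(j < m | (2 <= bucket y m j <= N)%N) G j * cis (t * lnn (bucket y m j))).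
  rewrite -(exchange_fiber_sum m N (bucket y m) (fun n j => G j * cis (t * lnn n))).
  rewrite !mulr_sumr; apply: eq_big_nat => n /andP[n2 _].
  rewrite natcpowE ?(ltnW n2)// /coeff -/G0 -mulr_suml.
  have nn0 : n%:R != 0 :> R[i] by rewrite pnatr_eq0 -lt0n ltnW.
  move: (cis _) (\sum_(_ < _ | _) _) => a b; move: nn0; move: (n%:R : R[i]) => nn nn0.
  rewrite [RHS]mulrCA; move: (m%:R^-1) (G0^-1) => mi gi.
  by rewrite -[LHS]/(nn * mi * gi * b * (nn^-1 * a)); field.
(* Error of rounding at one node. In a bucket between 2 and [N], [|G| <= n] multiplies a change of
   at most [H (2 e L2 + 1 / n)], giving at most [2 H]. Elsewhere the abscissa is below [U k0] or
   above [U K], no bump is positive, and the discarded value has modulus at most 1. *)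
have h3 j : (j < m)%N -> normc (Psi t (node m j) -
   (if (2 <= bucket y m j <= N)%N then G j * cis (t * lnn (bucket y m j)) else 0)) <= 1 + 2 * H.
  move=> jm; have s0 : sin (half_angle m j) != 0 :> R.
    by rewrite gt_eqF// sin_half_angle_gt0.
  pose E := cexp (t%:C * izeps y e (node m j)).
  have PE : Psi t (node m j) = G j * E by rewrite /Psi cexpD.
  have Re_le0 : complex.Re (t%:C * izeps y e (node m j)) <= 0.
    have := @Re_izeps_cis_le0 R y e _ e0 s0; rewrite -/(node m j).
    by case: (izeps _ _ _) => p q /= p0; rewrite mul0r subr0 mulr_ge0_le0.
  have E1 : normc E <= 1 by rewrite normc_cexp_le1.
  rewrite PE; case: ifPn => [/andP[n2 nN]|out].
    set n := bucket y m j in n2 nN *.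
    have /andP[u1 u2] := bucketP (ltnW n2) (erefl n).
    have n0 : 0 < n%:R :> R by rewrite ltr0n ltnW.
    have := Re_qfun_node_le Phi_gt0 Phi_incr k0 K y0 jm n2 u2.
    rewrite le_min => /andP[_ h].
    have Gn : normc (G j) <= n%:R.
      by rewrite normc_cexp -[leRHS]lnK ?posrE// ler_expR.
    have u0 : 0 < abscissa y m j by rewrite (lt_le_trans _ u1)// lnn_gt0.
    have uL : abscissa y m j ^+ 2 <= L2.
      rewrite lerXn2r ?nnegrE ?(ltW u0) ?ltW ?lnn_gt0 ?leqW//.
      by rewrite (lt_le_trans u2)// lnn_le.
    have En : normc (E - cis (t * lnn n)) <= H * (e * L2 * 2 + n%:R^-1).
      rewrite (le_trans (normc_cexp_sub_le _ _))//=.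
      have -> : t%:C * izeps y e (node m j) - (0 +i* (t * lnn n)) =
          t%:C * (izeps y e (node m j) - (0 +i* (abscissa y m j))) +
          t%:C * (0 +i* (abscissa y m j - lnn n)).
        have -> : (0 +i* (t * lnn n)) = t%:C * (0 +i* lnn n) :> R[i] by simpc.
        have -> : (0 +i* (abscissa y m j - lnn n)) =
           (0 +i* abscissa y m j) - (0 +i* lnn n) :> R[i] by simpc.
        by ring.
      rewrite -mulrDr normcMe normc_real ger0_norm//.
      apply: ler_pM => //; first exact: normc_ge0.
      rewrite (le_trans (normc_D_le _ _))// lerD//.
        apply: le_trans (izeps_cis_approx _ _ _) _ => //.
        by rewrite ler_wpM2r// ler_wpM2l// ltW.
      rewrite (le_trans (normc_le_ReIm _))//= normr0 add0r ger0_norm ?subr_ge0//.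
      by rewrite (le_trans _ (lnnS_sub_le (ltnW n2)))// lerD2r ltW.
    rewrite -mulrBr normcMe.
    apply: (@le_trans _ _ (n%:R * (H * (e * L2 * 2 + n%:R^-1)))).
      by rewrite ler_pM ?normc_ge0.
    rewrite [leLHS](_ : _ = H * (e * (2 * L2 * n%:R)) + H); last first.
      by field; rewrite gt_eqF.
    have : e * (2 * L2 * n%:R) <= 1.
      apply: le_trans e1; rewrite ler_pM2l//; apply: ler_wpM2l.
        by rewrite mulr_ge0.
      by rewrite ler_nat.
    nra.
  rewrite subr0 normcMe -[leRHS]mulr1 ler_pM ?normc_ge0//.
  rewrite (@le_trans _ _ 1)//; last by lra.
  rewrite normc_cexp_le1// Re_qfun_node_le0// => k /andP[_ kK'].
  move: out; rewrite !negb_and -!leNgt -!ltnNge => /orP[b2|bN]; apply/orP.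
    left; rewrite (le_trans (ltW (bucket_lt2 b2)))// lnn_le//.
    exact: tower_ge2.
  right; have b1 : (1 <= bucket y m j)%N by rewrite (leq_trans _ bN).
  have /andP[+ _] := bucketP b1 (erefl _); apply: le_trans.
  rewrite lnn_le ?(leq_trans _ (ltnW bN)) ?leq_tower//.
  exact/ltnW/tower_ge2.
have G0n : normc G0 = expR g by rewrite normc_cexp.
have G0neq : G0 != 0 := cexp_neq0 _.
have -> : psi%:C = G0^-1 * Psi t 0 by rewrite PsiE mulKf.
rewrite sumE -mulrBr normcMe normcVe G0n mulrC ler_pdivrMr ?expR_gt0//.
rewrite (le_trans (normc_B_trans (m%:R^-1 * \sum_(j < m) Psi t (node m j)) _ _))//.
have : normc (m%:R^-1 * \sum_(j < m) Psi t (node m j) - m%:R^-1 * \sum_(j < m | (2 <= bucket y m j <= N)%N) G j * cis (t * lnn (bucket y m j))) <= 1 + 2 * H.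
  rewrite -mulrBr [X in _ - X]big_mkcond/= -sumrB normcMe normcVe normc_nat.
  rewrite ler_pdivrMl// (le_trans (normc_sum _ _ _))//.
  have -> : m%:R * (1 + 2 * H) = \sum_(j < m) (1 + 2 * H).
    by rewrite sumr_const card_ord mulr_natl.
  by apply: ler_sum => j _; exact: h3.
rewrite normc_distC in h2 => h4; rewrite (le_trans (lerD h2 h4))//.
apply: (@le_trans _ _ (eta / 2 * L)); last by rewrite ler_wpM2l// divr_ge0// ltW.
rewrite /L [leRHS](_ : _ = ((y^-1 + 1) * c) / 2 + (2 + 2 * H)); last by field; rewrite gt_eqF//= gt_eqF.
have : 0 <= ((y^-1 + 1) * c) / 2 by rewrite divr_ge0 ?mulr_ge0//; lra.
lra.
Qed.

End ExponentialApproximation.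

(** * Density of exponential polynomials *)

Section Bernstein.
Context {R : realType}.
Implicit Types (f g : nat -> R) (x a c : R).

(* [(bernstein n f).[x]] is the expectation of [f S] for [S] binomial of
   parameters [n] and [x], computed by conditioning on the first trial. *)
Fixpoint bernstein n f : {poly R} :=
  if n is n'.+1 then 'X * bernstein n' (f \o succn) + (1 - 'X) * bernstein n' f
  else (f 0%N)%:P.

Lemma bernsteinS n f x : (bernstein n.+1 f).[x] =
  x * (bernstein n (f \o succn)).[x] + (1 - x) * (bernstein n f).[x].
Proof. by rewrite /= !hornerE. Qed.

Lemma bernstein_affine n f g a c x :
  (bernstein n (fun k => a * f k + c * g k)).[x] =
    a * (bernstein n f).[x] + c * (bernstein n g).[x].
Proof.
elim: n f g => [|n ih] f g; first by rewrite /= !hornerE.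
rewrite !bernsteinS.
have := ih (f \o succn) (g \o succn); rewrite /comp => ->.
by rewrite ih; ring.
Qed.

Lemma bernstein_cst n c x : (bernstein n (fun=> c)).[x] = c.
Proof.
elim: n => [|n ih]; first by rewrite /= !hornerE.
by rewrite bernsteinS /comp ih; ring.
Qed.

Lemma bernstein_le n f g x : 0 <= x <= 1 -> (forall k, f k <= g k) ->
  (bernstein n f).[x] <= (bernstein n g).[x].
Proof.
move=> /andP[x0 x1]; elim: n f g => [|n ih] f g fg; first by rewrite /= !hornerE.
by rewrite !bernsteinS lerD// ler_wpM2l ?subr_ge0 ?ih// => k; exact: fg.
Qed.

(** The second moment of a binomial variable about [a]: squared bias plus the variance
    [n x (1 - x)]. *)
Lemma bernstein_sqr n a x :
  (bernstein n (fun k => (k%:R - a) ^+ 2)).[x] =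
    (n%:R * x - a) ^+ 2 + n%:R * x * (1 - x).
Proof.
elim: n a => [|n ih] a; first by rewrite /= !hornerE; ring.
rewrite bernsteinS ih.
have -> : (fun k => (k%:R - a) ^+ 2) \o succn = fun k => (k%:R - (a - 1)) ^+ 2 :> R.
  by apply/funext => k /=; rewrite -natr1; congr (_ ^+ 2); ring.
by rewrite ih -natr1; ring.
Qed.

Definition bernstein_fun n (phi : R -> R) : {poly R} :=
  bernstein n.+1 (fun k => phi (k%:R / n.+1%:R)).

Lemma normr_bernstein_fun_le n phi M x : 0 <= x <= 1 ->
  (forall u, `|phi u| <= M) -> `|(bernstein_fun n phi).[x]| <= M.
Proof.
move=> x01 pM; rewrite ler_norml; apply/andP; split.
  rewrite -(bernstein_cst n.+1 (- M) x); apply: bernstein_le => // k.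
  by have := pM (k%:R / n.+1%:R); rewrite ler_norml => /andP[].
rewrite -[leRHS](bernstein_cst n.+1 M x); apply: bernstein_le => // k.
by have := pM (k%:R / n.+1%:R); rewrite ler_norml => /andP[].
Qed.

(** Chebyshev's argument: [|phi u - phi x| <= e / 2 + C (u - x)^2], by continuity near [x] and by
    boundedness elsewhere, and the Bernstein mean of the square tends to 0. Only continuity at [x]
    is assumed because the function it is applied to may jump elsewhere. *)
Lemma bernstein_fun_cvg phi M x : 0 <= x <= 1 ->
  (forall u, `|phi u| <= M) -> {for x, continuous phi} ->
  (bernstein_fun n phi).[x] @[n --> \oo] --> phi x.
Proof.
move=> x01 pM pc; have M0 : 0 <= M := le_trans (normr_ge0 _) (pM 0).
have /andP[x0 x1] := x01.
apply/cvgrPdist_le => e e0.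
have e20 : 0 < e / 2 by rewrite divr_gt0.
have /cvgrPdist_le /(_ _ e20) /nbhs_ballP[d /= d0 dP] := pc.
pose C := 2 * M / d ^+ 2.
have C0 : 0 <= C by apply: divr_ge0; [rewrite mulr_ge0|rewrite sqr_ge0].
have H u : `|phi u - phi x| <= e / 2 + C * (u - x) ^+ 2.
  have [ux|ux] := ltP `|x - u| d.
    rewrite distrC (le_trans (dP u ux))// lerDl.
    by rewrite mulr_ge0 ?sqr_ge0.
  apply: (@le_trans _ _ (2 * M)).
    rewrite (le_trans (ler_normB _ _))// mulr_natl mulr2n lerD//; exact: pM.
  rewrite (@le_trans _ _ (C * (u - x) ^+ 2))//; last by rewrite lerDr ltW.
  rewrite /C mulrAC ler_pdivlMr ?exprn_gt0// ler_wpM2l ?mulr_ge0//.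
  rewrite -[leRHS]real_normK ?num_real// lerXn2r ?nnegrE ?(ltW d0)//.
  by rewrite distrC.
near=> n.
have n0 : 0 < n.+1%:R :> R by [].
have E c r : (bernstein n.+1 (fun k => 1 * c + r / n.+1%:R ^+ 2 * (k%:R - n.+1%:R * x) ^+ 2)).[x] =
    c + r * (x * (1 - x)) / n.+1%:R.
  rewrite (bernstein_affine n.+1 (fun=> c)) bernstein_cst bernstein_sqr.
  by move: n0; move: (n.+1%:R : R) => N N0; field; rewrite gt_eqF.
have S (k : nat) : C / n.+1%:R ^+ 2 * (k%:R - n.+1%:R * x) ^+ 2 = C * (k%:R / n.+1%:R - x) ^+ 2.
  by move: n0; move: (n.+1%:R : R) => N N0; field; rewrite gt_eqF.
have Cn : C * (x * (1 - x)) / n.+1%:R <= e / 2.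
  apply: (@le_trans _ _ (C / n.+1%:R)).
    rewrite ler_wpM2r ?invr_ge0// ler_piMr// mulr_ile1 ?subr_ge0//; lra.
  rewrite ler_pdivrMr// mulrC -ler_pdivrMr//.
  near: n; exists (Num.trunc (C / (e / 2))) => // n /= nN.
  by rewrite (le_trans (ltW (truncnS_gt _)))// ler_nat.
rewrite distrC ler_norml; apply/andP; split.
  rewrite lerBrDr (@le_trans _ _ (phi x - e / 2 + (- C) * (x * (1 - x)) / n.+1%:R))//.
    by rewrite !mulNr; move: Cn; move: (C * _ / _) => q; lra.
  rewrite -E; apply: bernstein_le => // k; rewrite mul1r !mulNr S.
  have := H (k%:R / n.+1%:R); rewrite ler_norml => /andP[+ _].
  by move: (C * _) (phi (_ / _)) => q r; lra.
rewrite lerBlDr (@le_trans _ _ (phi x + e / 2 + C * (x * (1 - x)) / n.+1%:R))//; last first.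
  by move: Cn; move: (C * _ / _) => q; lra.
rewrite -E; apply: bernstein_le => // k; rewrite mul1r S.
have := H (k%:R / n.+1%:R); rewrite ler_norml => /andP[_].
by move: (C * _) (phi (_ / _)) => q r; lra.
Unshelve. all: by end_near. Qed.

End Bernstein.

Section ExponentialPolynomials.
Context {R : realType}.
Variable H : R.
Local Notation mu := (@lebesgue_measure R).
Local Notation I := (`]0%R, H[%classic : set R).

(** The outer factor removes the constant term: only the functions [expR (- (y * t))] with [0 < y]
    are obtained as limits. *)
Definition expoly (p : {poly R}) (t : R) : R := expR (- t) * p.[expR (- t)].

Definition sqdist (g h : R -> R) : \bar R :=
  (\int[mu]_(x in I) ((g x - h x) ^+ 2)%:E)%E.

Definition expoly_approx (g : R -> R) :=
  forall e : R, 0 < e -> exists p, (sqdist g (expoly p) <= e%:E)%E.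

Lemma continuous_expoly p : continuous (expoly p).
Proof.
move=> t; have ce : {for t, continuous (fun t : R => expR (- t))}.
  apply: continuous_comp; first exact: opp_continuous.
  exact: continuous_expR.
apply: cvgM => //; apply: (@continuous_comp _ _ _ (fun t => expR (- t)) (fun x => p.[x])) => //.
exact: continuous_horner.
Qed.

Lemma measurable_expoly p : measurable_fun I (expoly p).
Proof. by apply: measurable_funTS; apply: continuous_measurable_fun; exact: continuous_expoly. Qed.

Lemma measure_itv_lty : (mu I < +oo)%E.
Proof. by rewrite lebesgue_measure_itv/=; case: ifP => // _; rewrite -EFinB ltry. Qed.

Lemma integrable_cst_itv (c : R) : mu.-integrable I (fun=> c%:E).
Proof.
apply: (@measurable_bounded_integrable _ _ _ _ (cst c)) => //.
  exact: measure_itv_lty.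
exists `|c|; split; first exact: num_real.
by move=> M cM x _; exact: ltW.
Qed.

Lemma measurable_sqB (g h : R -> R) : measurable_fun I g -> measurable_fun I h ->
  measurable_fun I (fun x => ((g x - h x) ^+ 2)%:E).
Proof.
by move=> mg mh; apply/measurable_EFinP; apply: measurable_funX; exact: measurable_funB.
Qed.

Lemma sqdist_triangle (g k h : R -> R) :
  measurable_fun I g -> measurable_fun I k -> measurable_fun I h ->
  (sqdist g h <= 2%:E * sqdist g k + 2%:E * sqdist k h)%E.
Proof.
have sq0 (u v : R -> R) x : I x -> (0 <= ((u x - v x) ^+ 2)%:E)%E.
  by rewrite lee_fin sqr_ge0.
have sq20 (u v : R -> R) x : I x -> (0 <= 2%:E * ((u x - v x) ^+ 2)%:E)%E.
  by rewrite -EFinM lee_fin mulr_ge0 ?sqr_ge0.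
move=> mg mk mh; have mgk := measurable_sqB mg mk; have mkh := measurable_sqB mk mh.
have mgh := measurable_sqB mg mh.
rewrite /sqdist -!ge0_integralZl_EFin//; do ?[exact: sq0].
rewrite -ge0_integralD//; do ?[exact: sq20|exact: measurable_funeM].
apply: ge0_le_integral => //.
- exact: sq0.
- by apply: emeasurable_funD; exact: measurable_funeM.
move=> x _; rewrite -!EFinM -EFinD lee_fin.
by have := sqr_ge0 ((g x - k x) - (k x - h x)); rewrite !expr2; lra.
Qed.

Lemma expoly_approx_closed g : measurable_fun I g ->
  (forall e : R, 0 < e -> exists k, [/\ measurable_fun I k, expoly_approx k &
     (sqdist g k <= e%:E)%E]) -> expoly_approx g.
Proof.
move=> mg h e e0; have e40 : 0 < e / 4 by rewrite divr_gt0.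
have [k [mk kA gk]] := h _ e40; have [p kp] := kA _ e40; exists p.
apply: le_trans (sqdist_triangle mg mk (@measurable_expoly p)) _.
apply: (@le_trans _ _ (2%:E * (e / 4)%:E + 2%:E * (e / 4)%:E)%E).
  by rewrite leeD// lee_pmul2l.
by rewrite -!EFinM -EFinD lee_fin; lra.
Qed.

Lemma sqdist_dominated (g G : R -> R) (g_ : nat -> R -> R) :
  measurable_fun I g -> (forall n, measurable_fun I (g_ n)) ->
  (forall x, I x -> g_ n x @[n --> \oo] --> g x) ->
  (forall x n, I x -> `|g x - g_ n x| <= G x) ->
  mu.-integrable I (fun x => (G x ^+ 2)%:E) ->
  forall e : R, 0 < e -> exists n, (sqdist g (g_ n) <= e%:E)%E.
Proof.
move=> mg mg_ gg gG iG e e0.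
have mI : measurable I by exact: measurable_itv.
have := @dominated_convergence _ _ _ mu I mI
  (fun n x => ((g x - g_ n x) ^+ 2)%:E) (cst 0)%E (fun x => (G x ^+ 2)%:E)
  (fun n => measurable_sqB mg (mg_ n)) (measurable_cst _) _ iG _.
case=> [||_ _].
- apply: aeW => x Ix; apply: cvg_EFin; first by near=> n.
  have h : g x - g_ n x @[n --> \oo] --> (0 : R).
    by rewrite -(subrr (g x)); apply: cvgB; [exact: cvg_cst|exact: gg].
  rewrite /= -(mulr0 (0 : R)).
  rewrite (_ : fine \o _ = fun n => (g x - g_ n x) * (g x - g_ n x)).
    exact: (cvgM h h).
  by apply/funext => n /=; rewrite expr2.
- apply: aeW => x n Ix; rewrite /= lee_fin normrX lerXn2r// ?nnegrE.
    exact: le_trans (gG x n Ix).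
  exact: gG.
rewrite integral0 => /fine_cvgP[fin /cvgrPdist_lt /(_ e e0) h].
have [n _ /(_ n (leqnn n))[/= fn]] := filterI fin h.
rewrite /= sub0r normrN => nP; exists n; rewrite /sqdist -[leLHS]fineK// lee_fin.
by rewrite (le_trans (ler_norm _))// ltW.
Unshelve. all: by end_near. Qed.

(** In the variable [x = expR (- t)] the interval becomes [(expR (- H), 1)], away from 0, so [g] may
    be divided by [x] and the quotient, cut off below [expR (- H)], stays bounded. Its Bernstein
    polynomials converge pointwise and boundedly, hence in mean square. *)
Lemma expoly_approx_continuous (g : R -> R) (M : R) : 0 < H -> continuous g ->
  (forall x, `|g x| <= M) -> expoly_approx g.
Proof.
move=> H0 cg gM; have M0 : 0 <= M := le_trans (normr_ge0 _) (gM 0).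
pose a := expR (- H); have a0 : 0 < a := expR_gt0 _.
pose phi x := if x < a then 0 else g (- ln x) / x.
have phiM x : `|phi x| <= M / a.
  rewrite /phi; case: ltP => [_|ax]; first by rewrite normr0 divr_ge0// ltW.
  have x0 : 0 < x := lt_le_trans a0 ax.
  rewrite normrM normfV (gtr0_norm x0) ler_pM ?invr_ge0 ?(ltW x0)//.
  by rewrite lef_pV2.
have Ma0 : 0 <= M / a by rewrite divr_ge0// ltW.
move=> e e0.
have [|||||n nP] := @sqdist_dominated g (fun=> M + M / a) (fun n => expoly (bernstein_fun n phi)) _ _ _ _ _ e e0.
- by apply: measurable_funTS; exact: continuous_measurable_fun.
- by move=> n; exact: measurable_expoly.
- move=> x; rewrite /= in_itv/= => /andP[x0 xH].
  have ax : a < expR (- x) by rewrite ltr_expR ltrN2.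
  have -> : g x = expR (- x) * phi (expR (- x)).
    by rewrite /phi ltNge ltW//= expRK opprK mulrC divfK// gt_eqF// expR_gt0.
  apply: cvgM; first exact: cvg_cst.
  apply: (bernstein_fun_cvg _ phiM).
    by rewrite expR_ge0/= -expR0 ler_expR oppr_le0 ltW.
  have phiE : phi (expR (- x)) = g (- ln (expR (- x))) / expR (- x).
    by rewrite /phi ltNge (ltW ax).
  rewrite /prop_for /continuous_at phiE.
  have c1 : g (- ln u) / u @[u --> expR (- x)] --> g (- ln (expR (- x))) / expR (- x).
    apply: cvgM; last by apply: cvgV; [rewrite gt_eqF ?expR_gt0|exact: cvg_id].
    apply: (@continuous_comp _ _ _ (fun u => - ln u) g); last exact: cg.
    apply: (@continuous_comp _ _ _ (@ln R) (fun u => - u)); last exact: opp_continuous.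
    by apply: continuous_ln; exact: expR_gt0.
  apply: cvg_trans c1; apply: near_eq_cvg; near=> u.
  by rewrite /phi ltNge ltW//; near: u; exact: lt_nbhsr.
- move=> x n; rewrite /= in_itv/= => /andP[x0 xH].
  rewrite (le_trans (ler_normB _ _))// lerD// normrM ger0_norm ?expR_ge0//.
  have x1 : expR (- x) <= 1 by rewrite -expR0 ler_expR oppr_le0 ltW.
  rewrite -[leRHS]mul1r ler_pM ?expR_ge0//.
  by apply: normr_bernstein_fun_le => //; rewrite expR_ge0 x1.
- exact: integrable_cst_itv.
by exists (bernstein_fun n phi).
Unshelve. all: by end_near. Qed.
Lemma clip_dist (M a b : R) :
  `|Num.max (- M) (Num.min M a) - Num.max (- M) (Num.min M b)| <= `|a - b|.
Proof.
have h u v : u <= v -> `|Num.max (- M) (Num.min M u) - Num.max (- M) (Num.min M v)| <= `|u - v|.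
  move=> uv; rewrite [leRHS]distrC [leLHS]distrC [leRHS]ger0_norm ?subr_ge0//.
  rewrite ger0_norm; last first.
    by rewrite subr_ge0 /Order.max /Order.min; do ?case: ifPn; rewrite -?leNgt; lra.
  by rewrite /Order.max /Order.min; do ?case: ifPn; rewrite -?leNgt; lra.
have [/h//|/ltW/h] := leP a b.
by rewrite distrC [leRHS]distrC.
Qed.

Lemma clip_le (M a : R) : 0 <= M -> `|Num.max (- M) (Num.min M a)| <= M.
Proof.
by move=> M0; rewrite ler_norml le_max lexx/= ge_max ge_min lexx/= andbT; lra.
Qed.

Lemma clip_id (M a : R) : `|a| <= M -> Num.max (- M) (Num.min M a) = a.
Proof. by rewrite ler_norml => /andP[h1 h2]; rewrite (min_r h2) (max_r h1). Qed.

Lemma measurable_clip (M : R) (g : R -> R) : measurable_fun I g ->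
  measurable_fun I (fun x => Num.max (- M) (Num.min M (g x))).
Proof.
by move=> mg; apply: measurable_maxr; [exact: measurable_cst|apply: measurable_minr].
Qed.

Lemma continuous_clip (M : R) (g : R -> R) : continuous g ->
  continuous (fun x => Num.max (- M) (Num.min M (g x))).
Proof.
move=> cg x; apply/cvgrPdist_lt => e e0.
have /cvgrPdist_lt /(_ e e0) := cg x; apply: filterS => t.
exact: le_lt_trans (clip_dist _ _ _).
Qed.

(** Continuous functions approximate [g] in mean. Clipped to [[- M, M]] they approximate it in mean
    square, since the squared difference is then at most [2 M] times the unclipped difference. *)
Lemma expoly_approx_bounded (g : R -> R) (M : R) : 0 < H -> 0 < M ->
  measurable_fun I g -> (forall x, I x -> `|g x| <= M) -> expoly_approx g.
Proof.
move=> H0 M0 mg gM; apply: expoly_approx_closed => // e e0.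
have mI : measurable I by exact: measurable_itv.
have ig : mu.-integrable I (EFin \o g).
  apply: measurable_bounded_integrable => //; first exact: measure_itv_lty.
  exists M; split; first exact: num_real.
  by move=> M' MM' x Ix; rewrite /= (le_trans (gM x Ix))// ltW.
have [g_ [cg_ ig_ h]] := approximation_continuous_integrable mI measure_itv_lty ig.
have e1 : 0 < e / (2 * M) by rewrite divr_gt0// mulr_gt0.
have /fine_cvgP[fin /cvgrPdist_lt /(_ _ e1) h'] := h.
have [n _ /(_ n (leqnn n))[/= fn]] := filterI fin h'.
rewrite /= sub0r normrN => nP.
pose k x := Num.max (- M) (Num.min M (g_ n x)).
have ck : continuous k by exact: continuous_clip.
have mk : measurable_fun I k.
  by apply: measurable_funTS; exact: continuous_measurable_fun.
have mgn : measurable_fun I (g_ n).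
  by apply: measurable_funTS; exact: continuous_measurable_fun.
exists k; split => //.
  by apply: (@expoly_approx_continuous _ M) => // x; apply: clip_le; exact: ltW.
apply: (@le_trans _ _ (\int[mu]_(x in I) ((2 * M)%:E * `|(g x - g_ n x)%:E|))%E).
  apply: ge0_le_integral => //.
  - by move=> x _; rewrite lee_fin sqr_ge0.
  - exact: measurable_sqB.
  - apply: measurable_funeM; apply: measurableT_comp => //; apply/measurable_EFinP.
    exact: measurable_funB.
  move=> x Ix; rewrite -EFinM lee_fin -[leLHS]real_normK ?num_real// expr2.
  apply: ler_pM => //.
    rewrite (le_trans (ler_normB _ _))// mulr_natl mulr2n lerD//; first exact: gM.
    by apply: clip_le; exact: ltW.
  by rewrite -{1}(clip_id (gM x Ix)) clip_dist.
have mgg : measurable_fun I (fun x => `|(g x - g_ n x)%:E|%E).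
  by apply: measurableT_comp => //; apply/measurable_EFinP; exact: measurable_funB.
rewrite ge0_integralZl_EFin ?mulr_ge0 ?(ltW M0)//.
rewrite -[X in (_ * X)%E]fineK// -EFinM lee_fin mulrC -ler_pdivlMr ?mulr_gt0//.
by rewrite (le_trans (ler_norm _))// ltW.
Qed.

Lemma clip_sub_le (M a : R) : 0 <= M ->
  `|a - Num.max (- M) (Num.min M a)| <= `|a|.
Proof.
move=> M0; have [a0|a0] := leP 0 a.
  rewrite [leRHS]ger0_norm// ger0_norm; last first.
    by rewrite subr_ge0 /Order.max /Order.min; do ?case: ifPn; rewrite -?leNgt; lra.
  by rewrite /Order.max /Order.min; do ?case: ifPn; rewrite -?leNgt; lra.
rewrite distrC [leRHS]ltr0_norm// ger0_norm; last first.
  by rewrite subr_ge0 /Order.max /Order.min; do ?case: ifPn; rewrite -?leNgt; lra.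
by rewrite /Order.max /Order.min; do ?case: ifPn; rewrite -?leNgt; lra.
Qed.

(** Clipping [g] at height [n.+1] gives bounded functions that are eventually equal to [g] at each
    point, with error dominated by [|g|]. *)
Lemma expoly_approx_L2 (g : R -> R) : 0 < H -> measurable_fun I g ->
  (\int[mu]_(x in I) ((g x) ^+ 2)%:E < +oo)%E -> expoly_approx g.
Proof.
move=> H0 mg g2; apply: expoly_approx_closed => // e e0.
have mclip M := measurable_clip M mg.
have [|||||n nP] := @sqdist_dominated g (fun x => `|g x|)
    (fun n x => Num.max (- n.+1%:R) (Num.min n.+1%:R (g x))) _ _ _ _ _ e e0 => //.
- move=> x Ix; apply: cvg_near_cst; exists (Num.trunc `|g x|) => // n /= nx.
  by rewrite clip_id// (le_trans (ltW (truncnS_gt _)))// ler_nat.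
- by move=> x n _; exact: clip_sub_le.
- apply/integrableP; split.
    by apply/measurable_EFinP; apply: measurable_funX; exact: measurableT_comp.
  under eq_integral do rewrite /= real_normK ?num_real// ger0_norm ?sqr_ge0//.
  exact: g2.
exists (fun x => Num.max (- n.+1%:R) (Num.min n.+1%:R (g x))); split => //.
by apply: (@expoly_approx_bounded _ n.+1%:R) => // x _; exact: clip_le.
Qed.

End ExponentialPolynomials.

(** * Uniform limits of Dirichlet polynomials with arbitrarily small coefficients *)

Section SmallApproximation.
Context {R : realType}.
Variables (H : R) (Phi : nat -> R).
Hypothesis Phi_gt0 : forall n, (2 <= n)%N -> 0 < Phi n.

Local Notation term n t := (natcpow n ('i%C * t%:C - 1)).

(* Asking for coefficients below every multiple of [Phi] makes the class of
   approximable functions a vector space. *)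
Definition small_approx (F : R -> R[i]) := forall eta : R, 0 < eta ->
  exists N (a : nat -> R[i]), [/\ (2 <= N)%N,
    forall n, (2 <= n <= N)%N -> normc (a n) <= eta * Phi n &
    forall t, 0 <= t <= H ->
      normc (F t - \sum_(2 <= n < N.+1) a n * term n t) <= eta].

Lemma small_approx0 : small_approx (fun=> 0).
Proof.
move=> eta eta0; exists 2%N, (fun=> 0); split => // [n /andP[n2 _]|t _].
  by rewrite normc_zero mulr_ge0// ltW// Phi_gt0.
by rewrite big1 => [|n _]; rewrite ?mul0r// subrr normc_zero ltW.
Qed.

Lemma small_approxZ c F : small_approx F -> small_approx (fun t => c * F t).
Proof.
move=> FA eta eta0; have c0 : 0 < normc c + 1 by rewrite ltr_wpDl ?normc_ge0.
have [N [a [N2 aP FP]]] := FA _ (divr_gt0 eta0 c0).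
have cle : normc c * (eta / (normc c + 1)) <= eta.
  rewrite mulrA ler_pdivrMr// mulrC ler_wpM2l ?(ltW eta0)//; lra.
exists N, (fun n => c * a n); split => // [n nN|t tH].
  rewrite normcMe (le_trans (ler_wpM2l (normc_ge0 _) (aP n nN)))//.
  rewrite mulrA ler_wpM2r//; by case/andP: nN => n2 _; rewrite ltW// Phi_gt0.
rewrite (eq_bigr (fun n => c * (a n * term n t))) => [|n _]; last by rewrite mulrA.
rewrite -mulr_sumr -mulrBr normcMe.
by rewrite (le_trans (ler_wpM2l (normc_ge0 _) (FP t tH))).
Qed.

Lemma sum_trunc_nat (V : zmodType) (N M : nat) (F : nat -> V) : (N <= M)%N ->
  \sum_(2 <= n < M.+1) (if (n <= N)%N then F n else 0) = \sum_(2 <= n < N.+1) F n.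
Proof.
by move=> NM; rewrite -big_mkcond/= [RHS](big_nat_widen _ _ M.+1)//.
Qed.

Lemma small_approxD F G : small_approx F -> small_approx G ->
  small_approx (fun t => F t + G t).
Proof.
move=> FA GA eta eta0; have e2 : 0 < eta / 2 by rewrite divr_gt0.
have [N [a [N2 aP FP]]] := FA _ e2; have [M [b [M2 bP GP]]] := GA _ e2.
exists (maxn N M), (fun n => (if (n <= N)%N then a n else 0) + (if (n <= M)%N then b n else 0)).
split => [|n /andP[n2 nNM]|t tH]; first by rewrite leq_max N2.
  rewrite (le_trans (normc_D_le _ _))// (splitr eta) mulrDl.
  have h0 : 0 <= eta / 2 * Phi n by rewrite mulr_ge0 ?(ltW e2)// ltW// Phi_gt0.
  apply: lerD; case: ifP => h; rewrite ?normc_zero//; [apply: aP|apply: bP]; exact/andP.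
rewrite (eq_bigr (fun n => (if (n <= N)%N then a n * term n t else 0) +
     (if (n <= M)%N then b n * term n t else 0))); last first.
  by move=> n _; rewrite mulrDl; do 2 case: ifP; rewrite ?mul0r.
rewrite big_split/= !sum_trunc_nat ?leq_maxl ?leq_maxr// opprD addrACA.
by rewrite (le_trans (normc_D_le _ _))// (splitr eta) lerD ?FP ?GP.
Qed.

Lemma small_approx_sum d (c : nat -> R[i]) (F : nat -> R -> R[i]) :
  (forall k, small_approx (F k)) ->
  small_approx (fun t => \sum_(k < d) c k * F k t).
Proof.
move=> FA; elim: d => [|d ih].
  by under eq_fun do rewrite big_ord0; exact: small_approx0.
under eq_fun do rewrite big_ord_recr/=; apply: small_approxD => //.
exact: small_approxZ.
Qed.

Lemma expolyE (p : {poly R}) d t : (size p <= d)%N ->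
  expoly p t = \sum_(k < d) p`_k * expR (- (k.+1%:R * t)).
Proof.
move=> pd; rewrite /expoly (horner_coef_wide _ pd) mulr_sumr.
apply: eq_bigr => k _; rewrite mulrCA; congr (_ * _).
by rewrite -exprS -expRM_natl mulrN.
Qed.

Lemma small_approx_expoly (p q : {poly R}) :
  (forall y, 0 < y -> small_approx (fun t => (expR (- (y * t)))%:C)) ->
  small_approx (fun t => expoly p t +i* expoly q t).
Proof.
move=> h; pose d := maxn (size p) (size q).
have := @small_approx_sum d (fun k => p`_k +i* q`_k) _ (fun k => h k.+1%:R (ltr0Sn _ _)).
congr small_approx; apply/funext => t.
rewrite (expolyE t (leq_maxl (size p) (size q) : (_ <= d)%N)).
rewrite (expolyE t (leq_maxr (size p) (size q) : (_ <= d)%N)).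
elim/big_rec3: _ => // k x y z _ ->.
by simpc.
Qed.

End SmallApproximation.

(** * The norm of the space and the density criterion *)

Section L2Norm.
Context {R : realType}.
Variable H : R.
Local Notation mu := (@lebesgue_measure R).
Local Notation I := (`]0%R, H[%classic : set R).
Implicit Types f g : R -> R[i].

Definition sqint f : \bar R := (\int[mu]_(x in I) ((normc (f x)) ^+ 2)%:E)%E.

Definition cmeasurable f := measurable_fun I (fun t => complex.Re (f t)) /\
  measurable_fun I (fun t => complex.Im (f t)).

Lemma sqint_ge0 f : (0 <= sqint f)%E.
Proof. by apply: integral_ge0 => x _; rewrite lee_fin sqr_ge0. Qed.

Lemma L2normE f : L2norm H f = (sqint f `^ 2^-1)%E.
Proof.
rewrite /L2norm unlock /sqint; congr (_ `^ _)%E.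
rewrite [RHS]integral_mkcond; apply: eq_integral => x _.
rewrite /patch; case: ifP => _ /=; first by rewrite powR_mulrn ?ger0_norm ?normc_ge0.
by rewrite normr0 powR0// pnatr_eq0.
Qed.

Lemma L2norm_lty f : (L2norm H f < +oo)%E <-> (sqint f < +oo)%E.
Proof.
rewrite L2normE; split; last exact: poweR_lty.
by apply: lty_poweRy; rewrite invr_eq0 pnatr_eq0.
Qed.

Lemma L2norm_lt f (e : R) : 0 < e -> (sqint f < (e ^+ 2)%:E)%E ->
  (L2norm H f < e%:E)%E.
Proof.
move=> e0 fe; rewrite L2normE.
have := sqint_ge0 f; have : (sqint f < +oo)%E by rewrite (lt_le_trans fe)// leey.
move: fe; case: (sqint f) => [r| |] // re _ r0; rewrite poweR_EFin lte_fin.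
rewrite !lte_fin !lee_fin in re r0.
rewrite -[e]ger0_norm ?ltW// -sqrtr_sqr powR12_sqrt//.
by rewrite ltr_sqrt// exprn_gt0.
Qed.

Lemma sqint_lt_of_L2norm f (e : R) : 0 < e -> (L2norm H f < e%:E)%E ->
  (sqint f < (e ^+ 2)%:E)%E.
Proof.
move=> e0; rewrite L2normE; have := sqint_ge0 f.
case: (sqint f) => [r| |] //; last by rewrite poweRyr// invr_eq0 pnatr_eq0.
rewrite poweR_EFin !lte_fin lee_fin => r0; rewrite powR12_sqrt// => re.
by rewrite -[r]sqr_sqrtr// ltrXn2r// ?nnegrE ?sqrtr_ge0 ?ltW.
Qed.

Lemma measurable_normc_sqr f : cmeasurable f ->
  measurable_fun I (fun x => (normc (f x) ^+ 2)%:E).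
Proof.
move=> [mr mi]; apply/measurable_EFinP.
rewrite (_ : (fun x => _) = fun x => complex.Re (f x) ^+ 2 + complex.Im (f x) ^+ 2); last first.
  by apply/funext => x; exact: sqr_normc_ReIm.
by apply: measurable_funD; exact: measurable_funX.
Qed.

Lemma cmeasurableD f g : cmeasurable f -> cmeasurable g ->
  cmeasurable (fun t => f t + g t).
Proof.
move=> [fr fi] [gr gi]; split.
  rewrite (_ : (fun t => _) = fun t => complex.Re (f t) + complex.Re (g t)).
    exact: measurable_funD.
  by apply/funext => t; case: (f t) (g t) => a b [c d].
rewrite (_ : (fun t => _) = fun t => complex.Im (f t) + complex.Im (g t)).
  exact: measurable_funD.
by apply/funext => t; case: (f t) (g t) => a b [c d].
Qed.

Lemma cmeasurableZ c f : cmeasurable f -> cmeasurable (fun t => c * f t).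
Proof.
case: c => a b [fr fi]; split.
  rewrite (_ : (fun t => _) = fun t => a * complex.Re (f t) - b * complex.Im (f t)).
    by apply: measurable_funB; apply: measurable_funM.
  by apply/funext => t; case: (f t).
rewrite (_ : (fun t => _) = fun t => a * complex.Im (f t) + b * complex.Re (f t)).
  by apply: measurable_funD; apply: measurable_funM.
by apply/funext => t; case: (f t).
Qed.

Lemma cmeasurableB f g : cmeasurable f -> cmeasurable g ->
  cmeasurable (fun t => f t - g t).
Proof.
move=> mf /(cmeasurableZ (-1)) mg; have := cmeasurableD mf mg.
by congr cmeasurable; apply/funext => t; rewrite mulN1r.
Qed.

Definition ccontinuous f := continuous (fun t => complex.Re (f t)) /\
  continuous (fun t => complex.Im (f t)).

Lemma ccontinuous_measurable f : ccontinuous f -> cmeasurable f.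
Proof.
by case=> cr ci; split; apply: measurable_funTS; exact: continuous_measurable_fun.
Qed.

Lemma ccontinuous_cst c : ccontinuous (fun=> c).
Proof. by split=> t; exact: cvg_cst. Qed.

Lemma ccontinuousD f g : ccontinuous f -> ccontinuous g ->
  ccontinuous (fun t => f t + g t).
Proof.
move=> [fr fi] [gr gi]; split.
  rewrite (_ : (fun t => _) = fun t => complex.Re (f t) + complex.Re (g t)).
    by move=> t; apply: cvgD; [exact: fr|exact: gr].
  by apply/funext => t; case: (f t) (g t) => a b [c d].
rewrite (_ : (fun t => _) = fun t => complex.Im (f t) + complex.Im (g t)).
  by move=> t; apply: cvgD; [exact: fi|exact: gi].
by apply/funext => t; case: (f t) (g t) => a b [c d].
Qed.

Lemma ccontinuousZ c f : ccontinuous f -> ccontinuous (fun t => c * f t).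
Proof.
have cZ (a : R) (h : R -> R) : continuous h -> continuous (fun t => a * h t).
  by move=> ch t; apply: cvgM; [exact: cvg_cst|exact: ch].
case: c => a b [fr fi]; split.
  rewrite (_ : (fun t => _) = fun t => a * complex.Re (f t) - b * complex.Im (f t)).
    by move=> t; apply: cvgB; apply: cZ.
  by apply/funext => t; case: (f t).
rewrite (_ : (fun t => _) = fun t => a * complex.Im (f t) + b * complex.Re (f t)).
  by move=> t; apply: cvgD; apply: cZ.
by apply/funext => t; case: (f t).
Qed.

Lemma ccontinuous_sum (r : seq nat) (F : nat -> R -> R[i]) :
  (forall n, ccontinuous (F n)) -> ccontinuous (fun t => \sum_(n <- r) F n t).
Proof.
move=> FM; elim: r => [|n r ih].
  by under eq_fun do rewrite big_nil; exact: ccontinuous_cst.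
by under eq_fun do rewrite big_cons; exact: ccontinuousD.
Qed.

Lemma ccontinuous_natcpow n : ccontinuous (fun t => natcpow n ('i%C * t%:C - 1)).
Proof.
have c (t : R) : natcpow n ('i%C * t%:C - 1) =
   ((expR (- ln (n%:R : R))) * cos (t * ln n%:R)) +i*
   ((expR (- ln (n%:R : R))) * sin (t * ln n%:R)).
  rewrite /natcpow -cexpE; congr cexp.
  by rewrite mulrBl mul1r; simpc; congr (_ +i* _).
have cl (h : R -> R) : continuous h ->
    continuous (fun t : R => expR (- ln (n%:R : R)) * h (t * ln n%:R)).
  move=> ch t; apply: cvgM; first exact: cvg_cst.
  apply: (@continuous_comp _ _ _ (fun t : R => t * ln n%:R) h).
    exact: mulrr_continuous.
  exact: ch.
split.
  rewrite (_ : (fun t => _) = fun t => expR (- ln (n%:R : R)) * cos (t * ln n%:R)).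
    by apply: cl; exact: continuous_cos.
  by apply/funext => t; rewrite c.
rewrite (_ : (fun t => _) = fun t => expR (- ln (n%:R : R)) * sin (t * ln n%:R)).
  by apply: cl; exact: continuous_sin.
by apply/funext => t; rewrite c.
Qed.

Lemma sqint_bounded f (M : R) : cmeasurable f -> 0 <= M -> 0 <= H ->
  (forall x, I x -> normc (f x) <= M) -> (sqint f <= (M ^+ 2 * H)%:E)%E.
Proof.
move=> mf M0 H0 fM.
apply: (@le_trans _ _ (\int[mu]_(x in I) (cst (M ^+ 2)%:E x))%E).
  apply: ge0_le_integral => //.
  - by move=> x _; rewrite lee_fin sqr_ge0.
  - exact: measurable_normc_sqr.
  by move=> x Ix; rewrite lee_fin lerXn2r ?nnegrE ?normc_ge0// fM.
rewrite integral_cst//; apply: (@le_trans _ _ ((M ^+ 2)%:E * mu I)%E) => //.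
rewrite lebesgue_measure_itv/= lte_fin.
case: ltP => [_|]; first by rewrite -EFinD subr0.
by rewrite mule0 lee_fin mulr_ge0// sqr_ge0.
Qed.

Lemma sqint_triangle f g h : cmeasurable f -> cmeasurable g -> cmeasurable h ->
  (sqint (fun t => (f t - h t)%R) <= 2%:E * sqint (fun t => (f t - g t)%R)
     + 2%:E * sqint (fun t => (g t - h t)%R))%E.
Proof.
move=> mf mg mh; rewrite /sqint.
have mfg := measurable_normc_sqr (cmeasurableB mf mg).
have mgh := measurable_normc_sqr (cmeasurableB mg mh).
have mfh := measurable_normc_sqr (cmeasurableB mf mh).
have sq0 (u v : R -> R[i]) x : I x -> (0 <= (normc (u x - v x) ^+ 2)%:E)%E.
  by rewrite lee_fin sqr_ge0.
have sq20 (u v : R -> R[i]) x : I x -> (0 <= 2%:E * (normc (u x - v x) ^+ 2)%:E)%E.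
  by rewrite -EFinM lee_fin mulr_ge0 ?sqr_ge0.
rewrite -!ge0_integralZl_EFin//; do ?[exact: sq0].
rewrite -ge0_integralD//; do ?[exact: sq20|exact: measurable_funeM].
apply: ge0_le_integral => //.
- exact: sq0.
- by apply: emeasurable_funD; exact: measurable_funeM.
move=> x _; rewrite -!EFinM -EFinD lee_fin.
have := normc_B_trans (g x) (f x) (h x).
move: (normc_ge0 (f x - h x)) (normc_ge0 (f x - g x)) (normc_ge0 (g x - h x)).
move: (normc _) (normc _) (normc _) => p q r p0 q0 r0 pqr.
apply: (@le_trans _ _ ((q + p) ^+ 2)); first by rewrite lerXn2r ?nnegrE ?addr_ge0.
by have := sqr_ge0 (q - p); rewrite !expr2; lra.
Qed.

End L2Norm.

Section Density.
Context {R : realType}.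
Variables (H : R) (Phi : nat -> R).
Hypothesis H_gt0 : 0 < H.
Hypothesis Phi_gt0 : forall n, (2 <= n)%N -> 0 < Phi n.
Local Notation I := (`]0%R, H[%classic : set R).

Lemma ccontinuous_dirichlet f : dirichlet_polys Phi f -> ccontinuous f.
Proof.
move=> [N [a [_ _ ->]]]; apply: ccontinuous_sum => n; apply: ccontinuousZ.
exact: ccontinuous_natcpow.
Qed.

Lemma cmeasurable_dirichlet f : dirichlet_polys Phi f -> cmeasurable H f.
Proof. by move/ccontinuous_dirichlet; exact: ccontinuous_measurable. Qed.

Lemma normc_natcpow n (t : R) : (1 <= n)%N ->
  normc (natcpow n ('i%C * t%:C - 1)) = n%:R^-1.
Proof.
by move=> n1; rewrite natcpowE// normcMe normcVe normc_nat normc_cis mulr1.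
Qed.

Lemma dirichlet_sub_L2 : dirichlet_polys Phi `<=` L2 H.
Proof.
move=> f Sf; have [mr mi] := cmeasurable_dirichlet Sf; split => //.
apply/L2norm_lty; case: Sf => N [a [_ _ fE]].
have M0 : 0 <= \sum_(2 <= n < N.+1) normc (a n) by rewrite sumr_ge0// => n _; rewrite normc_ge0.
apply: le_lt_trans (sqint_bounded _ M0 (ltW H_gt0) _) _; last exact: ltry.
  by split.
move=> x _; rewrite fE (le_trans (normc_sum _ _ _))//.
apply: ler_sum_nat => n /andP[n2 _]; have n1 := ltnW n2.
by rewrite normcMe normc_natcpow// ler_piMr ?normc_ge0// invf_le1 ?ler1n ?ltr0n.
Qed.

Lemma dense_of_small_approx :
  (forall y, 0 < y -> small_approx H Phi (fun t => (expR (- (y * t)))%:C)) ->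
  dense_in_L2 H (dirichlet_polys Phi).
Proof.
move=> hA; split; first exact: dirichlet_sub_L2.
move=> f [mr mi /L2norm_lty f2] e e0.
have mf : cmeasurable H f by split.
(* The two parts of [f] contribute [2 d] and the Dirichlet polynomial at most [e^2 / 16]; doubled by
   the triangle inequality for squares, the total is [6 / 16] of [e^2]. *)
pose d := e ^+ 2 / 16; have d0 : 0 < d by rewrite divr_gt0 ?exprn_gt0.
have finite_part (g : R -> R) : (forall x, g x ^+ 2 <= normc (f x) ^+ 2) ->
    measurable_fun I g -> (\int[lebesgue_measure]_(x in I) ((g x) ^+ 2)%:E < +oo)%E.
  move=> gf mg; apply: le_lt_trans f2; apply: ge0_le_integral => //.
  - by move=> x _; rewrite lee_fin sqr_ge0.
  - by apply/measurable_EFinP; exact: measurable_funX.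
  - exact: measurable_normc_sqr.
  by move=> x _; rewrite lee_fin.
have [p pP] : exists p, (sqdist H (fun t => complex.Re (f t)) (expoly p) <= d%:E)%E.
  apply: expoly_approx_L2 => //; apply: finite_part => // x.
  by rewrite sqr_normc_ReIm lerDl sqr_ge0.
have [q qP] : exists q, (sqdist H (fun t => complex.Im (f t)) (expoly q) <= d%:E)%E.
  apply: expoly_approx_L2 => //; apply: finite_part => // x.
  by rewrite sqr_normc_ReIm lerDr sqr_ge0.
(* The cap at 1 keeps the coefficients below [Phi]; the quotient turns a uniform error into a
   squared norm of at most [e^2 / 16]. *)
pose eta := Num.min 1 (e / (4 * (H + 1))).
have eta0 : 0 < eta by rewrite lt_min ltr01 divr_gt0// mulr_gt0// addr_gt0.
have [N [a [N2 aP gP]]] := small_approx_expoly Phi_gt0 p q hA eta0.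
pose g t := \sum_(2 <= n < N.+1) a n * natcpow n ('i%C * t%:C - 1).
have Sg : dirichlet_polys Phi g.
  exists N, a; split => // n nN; rewrite (le_trans (aP n nN))//.
  by rewrite ler_piMl ?ge_min ?lexx// ltW// Phi_gt0//; case/andP: nN.
exists g => //.
pose P t := expoly p t +i* expoly q t.
have mP : cmeasurable H P by split; exact: measurable_expoly.
have mg := cmeasurable_dirichlet Sg.
have fP : (sqint H (fun t => (f t - P t)%R) <= (2 * d)%:E)%E.
  rewrite mulr_natl mulr2n EFinD; apply: le_trans (leeD pP qP).
  have mp := @measurable_expoly R H p; have mq := @measurable_expoly R H q.
  rewrite /sqdist -ge0_integralD//; last 4 first.
  - by move=> x _; rewrite lee_fin sqr_ge0.
  - exact: measurable_sqB.
  - by move=> x _; rewrite lee_fin sqr_ge0.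
  - exact: measurable_sqB.
  rewrite le_eqVlt; apply/orP; left; apply/eqP; apply: eq_integral => x _.
  by rewrite -EFinD sqr_normc_ReIm /P; case: (f x).
have Pg : (sqint H (fun t => (P t - g t)%R) <= (eta ^+ 2 * H)%:E)%E.
  apply: sqint_bounded; rewrite ?ltW//; first exact: cmeasurableB.
  by move=> x; rewrite /= in_itv/= => /andP[x0 xH]; apply: gP; rewrite !ltW.
have etaH : eta ^+ 2 * H <= e ^+ 2 / 16.
  have H1 : 0 < 4 * (H + 1) by rewrite mulr_gt0// addr_gt0.
  have h : eta * (4 * (H + 1)) <= e by rewrite -ler_pdivlMr// ge_min lexx orbT.
  have : (eta * (4 * (H + 1))) ^+ 2 <= e ^+ 2.
    by rewrite lerXn2r ?nnegrE ?(ltW e0)// mulr_ge0 ?(ltW eta0) ?(ltW H1).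
  rewrite exprMn => h2; rewrite ler_pdivlMr//; apply: le_trans h2.
  rewrite -mulrA; apply: ler_wpM2l; first exact: sqr_ge0.
  by rewrite !expr2; nra.
apply: L2norm_lt => //; apply: le_lt_trans (sqint_triangle mf mP mg) _.
apply: (@le_lt_trans _ _ (2%:E * (2 * d)%:E + 2%:E * (eta ^+ 2 * H)%:E)%E).
  by rewrite leeD// lee_pmul2l.
rewrite -!EFinM -EFinD lte_fin /d.
have : 0 < e ^+ 2 by rewrite exprn_gt0.
lra.
Qed.

End Density.

(** * Averages over two-point shifts *)

Section Averaging.
Context {R : realType}.
Local Notation mu := (@lebesgue_measure R).
Implicit Types (l : seq R).

(** The mean of [g] over random translations in which each entry of [l] is added with probability
    one half. The field is a parameter because both complex functions and their squared moduli are
    averaged. *)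
Fixpoint avg (F : fieldType) l (g : R -> F) (t : R) : F :=
  if l is e :: l' then (avg l' g t + avg l' g (t + e)) / 2%:R else g t.

Lemma avgB (F : fieldType) l (g h : R -> F) t :
  avg l (fun t => g t - h t) t = avg l g t - avg l h t.
Proof. by elim: l t => [//|e l ih] t /=; rewrite !ih -mulrBl; congr (_ / _); ring. Qed.

Lemma avgD (F : fieldType) l (g h : R -> F) t :
  avg l (fun t => g t + h t) t = avg l g t + avg l h t.
Proof. by elim: l t => [//|e l ih] t /=; rewrite !ih -mulrDl; congr (_ / _); ring. Qed.

Lemma avgZ (F : fieldType) l (c : F) (g : R -> F) t :
  avg l (fun t => c * g t) t = c * avg l g t.
Proof. by elim: l t => [//|e l ih] t /=; rewrite !ih mulrA -mulrDr. Qed.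

Lemma avg_cst (F : fieldType) l (c : F) t : (2%:R : F) != 0 ->
  avg l (fun=> c) t = c.
Proof.
move=> F2; elim: l t => [//|e l ih] t /=; rewrite !ih.
by rewrite (_ : c + c = c * 2%:R) ?mulfK// mulr_natr mulr2n.
Qed.

Lemma avg_sum (F : fieldType) l (r : seq nat) (g : nat -> R -> F) t :
  avg l (fun t => \sum_(n <- r) g n t) t = \sum_(n <- r) avg l (g n) t.
Proof.
elim: r => [|n r ih].
  rewrite big_nil; under [X in avg _ X]eq_fun do rewrite big_nil.
  by elim: l t => [//|e l ih] t /=; rewrite !ih addr0 mul0r.
rewrite big_cons -ih -avgD; congr (avg l _ t).
by apply/funext => s; rewrite big_cons.
Qed.

Definition multiplier (u : R) l : R[i] := \prod_(e <- l) ((1 + cis (u * e)) / 2%:R).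

Lemma avg_cis l u t : avg l (fun t => cis (t * u)) t = multiplier u l * cis (t * u).
Proof.
rewrite /multiplier; elim: l t => [|e l ih] t /=; first by rewrite big_nil mul1r.
rewrite !ih big_cons (mulrDl t e u) cisD (mulrC e u); ring.
Qed.

Lemma normc_half_sum_le1 (x : R) : normc ((1 + cis x) / 2%:R) <= 1.
Proof.
rewrite normc_div normc_nat ler_pdivrMr// mul1r.
by rewrite (le_trans (normc_D_le _ _))// normc_one normc_cis.
Qed.

(** The cosine is nonpositive here, so the squared modulus [(1 + cos x) / 2] is at most 1/2; 3/4 is
    a rational bound above its root. *)
Lemma normc_half_sum_le (x : R) : pi / 2 <= x <= pi ->
  normc ((1 + cis x) / 2%:R) <= 3 / 4.
Proof.
move=> /andP[x1 x2].
have c0 : cos x <= 0.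
  rewrite -[x](subrK (pi / 2)) cosDpihalf oppr_le0 sin_ge0_pi//.
  by have := pi_ge0 R; lra.
rewrite normc_div normc_nat ler_pdivrMr//.
rewrite -ler_sqr ?nnegrE ?normc_ge0//.
rewrite sqr_normc_ReIm cisE; simpc => /=.
have := cos2Dsin2 x; rewrite !expr2; lra.
Qed.

Lemma multiplier_cat u l1 l2 :
  multiplier u (l1 ++ l2) = multiplier u l1 * multiplier u l2.
Proof. by rewrite /multiplier big_cat. Qed.

Lemma normc_multiplier_le1 u l : normc (multiplier u l) <= 1.
Proof.
rewrite /multiplier; elim: l => [|e l ih]; first by rewrite big_nil normc_one.
by rewrite big_cons normcMe mulr_ile1 ?normc_ge0// normc_half_sum_le1.
Qed.

Lemma multiplier_nseq u n e :
  multiplier u (nseq n e) = ((1 + cis (u * e)) / 2%:R) ^+ n.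
Proof.
rewrite /multiplier; elim: n => [|n ih]; first by rewrite big_nil expr0.
by rewrite /= big_cons ih exprS.
Qed.

(** Jensen's inequality for the square, one shift at a time. *)
Lemma sqr_normc_avg_le l (g : R -> R[i]) t :
  normc (avg l g t) ^+ 2 <= avg l (fun t => normc (g t) ^+ 2) t.
Proof.
elim: l t => [//|e l ih] t /=.
apply: le_trans (_ : (normc (avg l g t) ^+ 2 + normc (avg l g (t + e)) ^+ 2) / 2 <= _).
  rewrite normc_div normc_nat expr_div_n.
  have := normc_D_le (avg l g t) (avg l g (t + e)).
  move: (normc_ge0 (avg l g t + avg l g (t + e))) (normc_ge0 (avg l g t)) (normc_ge0 (avg l g (t + e))).
  move: (normc (avg l g t + avg l g (t + e))) (normc (avg l g t)) (normc (avg l g (t + e))) => p q r p0 q0 r0 pqr.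
  apply: (@le_trans _ _ ((q + r) ^+ 2 / 2 ^+ 2)).
    by rewrite ler_wpM2r// ?invr_ge0 ?exprn_ge0// lerXn2r ?nnegrE ?addr_ge0.
  by have := sqr_ge0 (q - r); rewrite !expr2; lra.
by rewrite ler_pM2r ?invr_gt0// lerD.
Qed.

Lemma avg_ge0 l (g : R -> R) t : (forall t, 0 <= g t) -> 0 <= avg l g t.
Proof. by move=> g0; elim: l t => [//|e l ih] t /=; rewrite divr_ge0// addr_ge0. Qed.

Lemma continuous_avg l (g : R -> R) : continuous g -> continuous (avg l g).
Proof.
move=> cg; elim: l => [//|e l ih] t /=.
apply: cvgM; last exact: cvg_cst.
apply: cvgD; first exact: ih.
apply: (@continuous_comp _ _ _ (fun t => t + e) (avg l g)); last exact: ih.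
by apply: cvgD; [exact: cvg_id|exact: cvg_cst].
Qed.

Lemma integral_shift (g : R -> R) (a b e : R) : a <= b -> continuous g ->
  (\int[mu]_(x in `[a, b]) (g (x + e)%R)%:E = \int[mu]_(x in `[(a + e)%R, (b + e)%R]) (g x)%:E)%E.
Proof.
move=> ab cg.
have dx x : is_derive x (1:R) (fun x : R => x + e) 1.
  by rewrite -[1 in X in is_derive _ _ _ X]addr0; apply: is_deriveD.
have d1 : derive1 (fun x : R => x + e) = cst 1.
  by apply/funext => x; rewrite derive1E; have [_ ->] := dx x.
have cF : continuous (fun x : R => x + e).
  by move=> x; apply: cvgD; [exact: cvg_id|exact: cvg_cst].
rewrite (@integration_by_substitution_increasing _ (fun x => x + e) g a b)//.
- by apply: eq_integral => x _; rewrite fctE d1 /= mulr1.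
- by move=> x y _ _ xy; rewrite ltrD2r.
- by rewrite d1 => x _; exact: cvg_cst.
- by rewrite d1; exact: is_cvg_cst.
- by rewrite d1; exact: is_cvg_cst.
- split; first by move=> x _; have [] := dx x.
    by apply: cvg_at_right_filter; exact: cF.
  by apply: cvg_at_left_filter; exact: cF.
- exact: continuous_subspaceT.
Qed.

Lemma integral_itv_continuous_le (g : R -> R) (a b c d : R) : continuous g ->
  (forall t, 0 <= g t) -> c <= a -> b <= d ->
  (\int[mu]_(x in `[a, b]) (g x)%:E <= \int[mu]_(x in `[c, d]) (g x)%:E)%E.
Proof.
move=> cg g0 ca bd; apply: ge0_subset_integral => //.
- apply/measurable_EFinP; apply: measurable_funTS; exact: continuous_measurable_fun.
- by move=> x _; rewrite lee_fin.
by apply: subset_itvScc.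
Qed.

(** Each translate of the window stays inside the window extended by the total shift, so both halves
    of every average are bounded by the same integral. *)
Lemma integral_avg_le l (g : R -> R) (a b : R) : a <= b -> continuous g ->
  (forall t, 0 <= g t) -> all (fun e => 0 <= e) l ->
  (\int[mu]_(x in `[a, b]) (avg l g x)%:E <=
   \int[mu]_(x in `[a, (b + \sum_(e <- l) e)%R]) (g x)%:E)%E.
Proof.
move=> + cg g0; elim: l a b => [|e l ih] a b ab; first by rewrite big_nil addr0.
move=> /= /andP[e0 l0].
have ca : continuous (avg l g) by exact: continuous_avg.
have a0 t : 0 <= avg l g t by exact: avg_ge0.
have mavg (h : R -> R) D : continuous h -> measurable_fun D (fun x => (h x)%:E).
  by move=> ch; apply/measurable_EFinP/measurable_funTS; exact: continuous_measurable_fun.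
have cae : continuous (fun x => avg l g (x + e)).
  move=> x; apply: (@continuous_comp _ _ _ (fun t => t + e) (avg l g)); last exact: ca.
  by apply: cvgD; [exact: cvg_id|exact: cvg_cst].
have S0 : 0 <= \sum_(e <- l) e.
  by rewrite big_seq sumr_ge0// => i /(allP l0).
pose J : \bar R := (\int[mu]_(x in `[a, (b + \sum_(e <- e :: l) e)%R]) (g x)%:E)%E.
have h1 : (\int[mu]_(x in `[a, b]) (avg l g x)%:E <= J)%E.
  apply: le_trans (ih _ _ ab l0) _; apply: integral_itv_continuous_le => //.
  by rewrite big_cons; lra.
have h2 : (\int[mu]_(x in `[a, b]) (avg l g (x + e)%R)%:E <= J)%E.
  rewrite integral_shift//; apply: le_trans (ih _ _ _ l0) _; first by rewrite lerD2r.
  apply: integral_itv_continuous_le => //; first by rewrite lerDl.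
  by rewrite big_cons addrA.
have -> : (\int[mu]_(x in `[a, b]) ((avg l g x + avg l g (x + e)) / 2)%R%:E =
  (2^-1)%:E * (\int[mu]_(x in `[a, b]) (avg l g x)%:E + \int[mu]_(x in `[a, b]) (avg l g (x + e)%R)%:E))%E.
  rewrite -ge0_integralD//; last 4 first.
  - by move=> x _; rewrite lee_fin.
  - exact: mavg.
  - by move=> x _; rewrite lee_fin.
  - exact: (mavg (fun x => avg l g (x + e))).
  rewrite -ge0_integralZl_EFin//; last 2 first.
  - by move=> x _; rewrite -EFinD lee_fin addr_ge0.
  - by apply: emeasurable_funD; [exact: mavg|exact: (mavg (fun x => avg l g (x + e)))].
  by apply: eq_integral => x _; rewrite -EFinD -EFinM mulrC.
apply: (@le_trans _ _ ((2^-1)%:E * (J + J))%E).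
  by rewrite lee_pmul2l ?lte_fin ?invr_gt0// leeD.
rewrite -/J; case: J {h1 h2} => [r| |]; rewrite ?addye ?addNye// -?EFinD -?EFinM.
- by rewrite lee_fin; lra.
- by rewrite gt0_muley ?lte_fin ?invr_gt0.
- by rewrite gt0_muleNy ?lte_fin ?invr_gt0.
Qed.

End Averaging.

(** * Failure of density when the series is bounded *)

Section NotDense.
Context {R : realType}.

(** If every tail could exceed [d], concatenating blocks of sum above [d] would exceed [B]. *)
Lemma sum_tail_le (x : nat -> R) (B d : R) : (forall k, 0 <= x k) ->
  (forall K, \sum_(0 <= k < K) x k <= B) -> 0 < d ->
  exists k0, forall K, \sum_(k0 <= k < K) x k <= d.
Proof.
move=> x0 xB d0; apply: contrapT => H.
have big n : exists K, n%:R * d <= \sum_(0 <= k < K) x k.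
  elim: n => [|n [K ih]]; first by exists 0%N; rewrite mul0r big_geq.
  have [L LP] : exists L, d < \sum_(K <= k < L) x k.
    apply: contrapT => H'; apply: H; exists K => L; rewrite leNgt; apply/negP => h.
    by apply: H'; exists L.
  have KL : (K <= L)%N.
    by rewrite leqNgt; apply/negP => h; move: LP; rewrite big_geq ?(ltnW h)// ltNge ltW.
  by exists L; rewrite (big_cat_nat _ (n := K))//= -natr1 mulrDl mul1r lerD// ltW.
have [K KP] := big (Num.trunc (B / d)).+1.
have := le_trans KP (xB K); rewrite leNgt => /negP; apply.
by rewrite -ltr_pdivrMr// truncnS_gt.
Qed.

Lemma sum_arith_geom K : \sum_(0 <= k < K) k.+1%:R / 2 ^+ k <= 4 :> R.
Proof.
suff -> : \sum_(0 <= k < K) k.+1%:R / 2 ^+ k = 4 - (2 * K%:R + 4) / 2 ^+ K :> R.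
  by rewrite gerBl divr_ge0 ?exprn_ge0.
elim: K => [|K ih]; first by rewrite big_geq// expr0 mulr0 add0r divr1 subrr.
rewrite big_nat_recr//= ih -natr1 exprS; have : (2 : R) ^+ K != 0 by rewrite expf_neq0.
by move: (2 ^+ K) => p p0; field.
Qed.

Variable Phi : nat -> R.
Hypothesis Phi_gt0 : forall n, (2 <= n)%N -> 0 < Phi n.
Hypothesis Phi_incr : forall m n, (2 <= m)%N -> (m <= n)%N -> Phi m <= Phi n.

Local Notation lnn n := (ln (n%:R : R)).
Local Notation T k := (tower 2 k).
Local Notation U k := (lnn (T k)).

(** Subtracting the value at 2 makes the terms nonnegative; the weights are summable, so divergence
    is unaffected. *)
Definition psi n : R := ln (Phi n) - ln (Phi 2).

Lemma psi_ge0 n : (2 <= n)%N -> 0 <= psi n.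
Proof. by move=> n2; rewrite subr_ge0 ler_ln ?posrE ?Phi_gt0// Phi_incr. Qed.

Lemma psi_le m n : (2 <= m)%N -> (m <= n)%N -> psi m <= psi n.
Proof.
move=> m2 mn; have n2 := leq_trans m2 mn.
by rewrite lerD2r ler_ln ?posrE ?Phi_gt0// Phi_incr.
Qed.

Variable B : R.
Hypothesis psi_sum_le :
  forall N, \sum_(2 <= n < N) psi n / (n%:R * lnn n ^+ 2) <= B.

Let T2 k : (2 <= T k)%N. Proof. exact: tower_ge2. Qed.
Let U0 k : 0 < U k. Proof. exact: lnn_gt0. Qed.

(** Condensation from the left ends of the blocks: since [U] doubles, [1 / U k] is twice
    [1 / U k - 1 / U k.+1], which the weights of the block dominate. *)
Lemma sum_psi_tower_le K : \sum_(0 <= k < K) psi (T k) / U k <= 2 * B.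
Proof.
suff h : \sum_(0 <= k < K) psi (T k) / U k <=
    2 * \sum_(2 <= n < T K) psi n / (n%:R * lnn n ^+ 2).
  by rewrite (le_trans h)// ler_pM2l.
elim: K => [|K ih]; first by rewrite !big_geq// mulr0.
rewrite big_nat_recr//= [X in _ <= 2 * X](big_cat_nat _ (n := T K)) ?leq_tower//= mulrDr lerD//.
apply: (@le_trans _ _ (2 * \sum_(T K <= n < T K.+1) psi (T K) / (n%:R * lnn n ^+ 2))).
  rewrite -mulr_sumr mulrCA; apply: ler_wpM2l; first exact: psi_ge0.
  apply: (@le_trans _ _ (2 * ((U K)^-1 - (U K.+1)^-1))).
    rewrite ln_towerS; have := U0 K; move: (lnn _) => u u0.
    by rewrite le_eqVlt; apply/orP; left; apply/eqP; field; rewrite gt_eqF.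
  by rewrite ler_pM2l// sum_log_weight_ge// leq_tower.
rewrite ler_pM2l//; apply: ler_sum_nat => n /andP[n1 n2].
apply: ler_wpM2r; last exact: psi_le.
by rewrite invr_ge0 mulr_ge0// sqr_ge0.
Qed.

(** For [log n] between [U k] and [U k.+1 = 2 U k] the phase [log n * shift_size k] lies between
    [pi / 2] and [pi], where one average contracts. *)
Definition shift_size k : R := pi / 2 / U k.
(** Each repetition gains a factor at most [expR (- (1 / 4))]. The term [psi] cancels the growth of
    [Phi] on the block; the extra [2 k.+1] yields the factor [1 / log^2 n] that makes the sum over
    [n] converge. *)
Definition shift_mult k := (Num.trunc (4 * (psi (T k.+1) + 2 * k.+1%:R))).+1.
Definition shifts k0 K := flatten [seq nseq (shift_mult k) (shift_size k) | k <- index_iota k0 K].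

Lemma shift_size_ge0 k : 0 <= shift_size k.
Proof. by rewrite divr_ge0 ?(ltW (U0 k))// divr_ge0// pi_ge0. Qed.

Lemma shifts_ge0 k0 K : all (fun e => 0 <= e) (shifts k0 K).
Proof.
apply/allP => e /flattenP[s /mapP[k _ ->]].
by rewrite mem_nseq => /andP[_ /eqP ->]; exact: shift_size_ge0.
Qed.

Lemma sum_shifts k0 K :
  \sum_(e <- shifts k0 K) e = \sum_(k0 <= k < K) (shift_mult k)%:R * shift_size k.
Proof.
rewrite /shifts; move: shift_mult shift_size => f g.
elim: (index_iota k0 K) => [|k s ih] /=; first by rewrite !big_nil.
by rewrite big_cat/= ih [RHS]big_cons big_nseq iter_addr_0 mulr_natl.
Qed.

Lemma U_ge k : 2 ^+ k / 2 <= U k.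
Proof.
by rewrite ln_tower ler_wpM2l ?exprn_ge0//; have := @ln2_ge_half R; rewrite div1r.
Qed.

Lemma U_le k : U k <= expR k%:R.
Proof.
rewrite ln_tower -[k%:R]mulr1 expRM_natl.
have h : 2 <= expR 1 :> R by apply: le_trans (expR_ge1Dx _); lra.
rewrite (@le_trans _ _ (2 ^+ k))//; last by rewrite lerXn2r// nnegrE ?expR_ge0.
rewrite ler_piMr ?exprn_ge0//.
by have := @le_ln1Dx R 1; rewrite (_ : 1 + 1 = 2)//; apply; lra.
Qed.

(** Both terms on the right are summable in [k]: the first by the hypothesis on the series, the
    second geometrically, as [U k >= 2^k / 2]. *)
Lemma shift_cost_le k : (shift_mult k)%:R * shift_size k <=
  16 * (psi (T k.+1) / U k.+1) + 36 * (k.+1%:R / 2 ^+ k).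
Proof.
have u0 := U0 k; have p0 : 0 <= psi (T k.+1) by exact: psi_ge0.
have k1 : 1 <= k.+1%:R :> R by rewrite ler1n.
have m1 : (shift_mult k)%:R <= 4 * (psi (T k.+1) + 2 * k.+1%:R) + 1.
  have q0 : 0 <= 4 * (psi (T k.+1) + 2 * k.+1%:R) by lra.
  rewrite /shift_mult -addn1 natrD lerD2r.
  by have /andP[] := truncn_itv q0.
have e1 : shift_size k <= 2 / U k.
  by rewrite ler_pM2r ?invr_gt0// ltW// pihalf_lt2.
apply: (@le_trans _ _ ((4 * psi (T k.+1) + 9 * k.+1%:R) * (2 / U k))).
  apply: ler_pM => //; [exact: shift_size_ge0|apply: le_trans m1 _; lra].
rewrite mulrDl; apply: lerD.
  rewrite ln_towerS le_eqVlt; apply/orP; left; apply/eqP.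
  by field; rewrite gt_eqF.
have u1 := U_ge k; have q0 : 0 < 2 ^+ k :> R by rewrite exprn_gt0.
rewrite [leRHS](_ : _ = 9 * k.+1%:R * (2 / (2 ^+ k / 2))); last by field; rewrite gt_eqF.
rewrite ler_wpM2l ?mulr_ge0// ler_pM2l// lef_pV2 ?posrE ?divr_gt0//.
Qed.

Lemma sum_shifts_small (d : R) : 0 < d -> exists k0, forall K,
  \sum_(e <- shifts k0 K) e <= d.
Proof.
move=> d0.
have [|K|k0 k0P] := @sum_tail_le (fun k => (shift_mult k)%:R * shift_size k) (16 * (2 * B) + 36 * 4) d _ _ d0.
- by move=> k; rewrite mulr_ge0// shift_size_ge0.
- apply: le_trans (ler_sum _ (fun k _ => shift_cost_le k)) _.
  rewrite big_split/= -!mulr_sumr lerD// ler_pM2l//; last exact: sum_arith_geom.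
  apply: le_trans (sum_psi_tower_le K.+1); rewrite big_nat_recl//= lerDr.
  by rewrite divr_ge0 ?(ltW (U0 _))// psi_ge0.
by exists k0 => K; rewrite sum_shifts.
Qed.

Lemma tower_locate k0 K n : (T k0 <= n < T K)%N ->
  exists2 k, (k0 <= k < K)%N & (T k <= n < T k.+1)%N.
Proof.
elim: K => [|K ih] /andP[n1 n2].
  by have := leq_ltn_trans n1 n2; rewrite ltnNge leq_tower.
have [nK|nK] := ltnP n (T K).
  have [|k /andP[k1 k2] kP] := ih; first by rewrite n1.
  by exists k => //; rewrite k1 ltnW.
exists K; last by rewrite nK.
rewrite ltnSn andbT leqNgt; apply/negP => h.
by have := leq_ltn_trans n1 n2; rewrite ltnNge leq_tower.
Qed.

(** Only the shifts of the block containing [n] are used, all other factors having modulus at most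
    1. They give [expR (- psi n)] times [expR (- (2 * k.+1))], and
    [log n <= U k.+1 <= expR k.+1]. *)
Lemma normc_multiplier_shifts k0 K n : (T k0 <= n < T K)%N ->
  normc (multiplier (lnn n) (shifts k0 K)) <= Phi 2 / Phi n / lnn n ^+ 2.
Proof.
move=> nP; have [k /andP[k1 k2] /andP[n1 n2]] := tower_locate nP.
have n2' : (2 <= n)%N := leq_trans (T2 k) n1.
have mk : normc (multiplier (lnn n) (shifts k0 K)) <=
    normc (multiplier (lnn n) (nseq (shift_mult k) (shift_size k))).
  have : k \in index_iota k0 K by rewrite mem_index_iota k1.
  rewrite /shifts; move: shift_mult shift_size => f g.
  elim: (index_iota k0 K) => [//|j s ih] /=.
  rewrite multiplier_cat normcMe in_cons => /predU1P[<-|/ih h].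
    by rewrite ler_piMr ?normc_ge0 ?normc_multiplier_le1.
  by rewrite (le_trans _ h)// ler_piMl ?normc_ge0 ?normc_multiplier_le1.
apply: (le_trans mk); rewrite multiplier_nseq normc_exp.
have u0 := U0 k.
have h1 : normc ((1 + cis (lnn n * shift_size k)) / 2%:R) <= 3 / 4 :> R.
  apply: normc_half_sum_le; rewrite /shift_size; apply/andP; split.
    rewrite mulrCA ler_peMr ?divr_ge0 ?pi_ge0// ler_pdivlMr// mul1r.
    by rewrite lnn_le// (leq_trans _ (T2 k)).
  rewrite [leRHS](_ : pi = pi / 2 * 2 :> R); last by rewrite divfK.
  rewrite mulrCA ler_wpM2l ?divr_ge0 ?pi_ge0//.
  by rewrite ler_pdivrMr// -ln_towerS lnn_le ?(ltnW n2)// (leq_trans _ n2').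
have h2 : normc ((1 + cis (lnn n * shift_size k)) / 2%:R) <= expR (- (1 / 4)) :> R.
  by apply: (le_trans h1); apply: le_trans (expR_ge1Dx _); lra.
apply: (@le_trans _ _ (expR (- (1 / 4)) ^+ shift_mult k)).
  by rewrite lerXn2r// nnegrE ?normc_ge0 ?expR_ge0.
rewrite -expRM_natl.
apply: (@le_trans _ _ (expR (- psi n) * expR (- (2 * k.+1%:R)))).
  rewrite -expRD ler_expR.
  have := ltW (truncnS_gt (4 * (psi (T k.+1) + 2 * k.+1%:R))); rewrite -/(shift_mult k).
  have := psi_le n2' (ltnW n2); lra.
apply: ler_pM; rewrite ?expR_ge0//.
  rewrite /psi opprB expRB !lnK ?posrE ?Phi_gt0//.
rewrite expRN lef_pV2 ?posrE ?exprn_gt0 ?lnn_gt0 ?expR_gt0//.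
rewrite expRM_natl lerXn2r ?nnegrE ?expR_ge0 ?(ltW (lnn_gt0 _))//.
by apply: le_trans (U_le k.+1); rewrite lnn_le ?(ltnW n2)// (leq_trans _ n2').
Qed.

Variable H : R.
Hypothesis H_gt0 : 0 < H.

(** Terms below [T k0] are bounded trivially; the damping of the others cancels [Phi n] and leaves
    [Phi 2 / (n log^2 n)]. The bound is independent of [N], [K], [t] and the coefficients. *)
Lemma avg_dirichlet_le k0 K N (a : nat -> R[i]) t : (2 <= N)%N -> (N < T K)%N ->
  (forall n, (2 <= n <= N)%N -> normc (a n) <= Phi n) ->
  normc (avg (shifts k0 K)
      (fun t => \sum_(2 <= n < N.+1) a n * natcpow n ('i%C * t%:C - 1)) t) <=
    \sum_(2 <= n < T k0) Phi n / n%:R + Phi 2 * (2 / ln 2).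
Proof.
move=> N2 NK aP; rewrite avg_sum (le_trans (normc_sum _ _ _))//.
have P2 : 0 < Phi 2 by exact: Phi_gt0.
have F0 n : (2 <= n)%N -> 0 <= Phi n / n%:R.
  by move=> n2; rewrite divr_ge0// ltW// Phi_gt0.
apply: (@le_trans _ _ (\sum_(2 <= n < N.+1)
   ((if (n < T k0)%N then Phi n / n%:R else 0) + Phi 2 * (n%:R * lnn n ^+ 2)^-1))).
  apply: ler_sum_nat => n /andP[n2 nN]; have n1 := ltnW n2.
  have n0 : 0 < n%:R :> R by rewrite ltr0n.
  have l0 := @lnn_gt0 R n n2.
  rewrite avgZ; under [X in avg _ X]eq_fun do rewrite natcpowE//.
  rewrite avgZ avg_cis 3!normcMe normcVe normc_nat normc_cis mulr1.
  have w0 : 0 <= Phi 2 * (n%:R * lnn n ^+ 2)^-1.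
    by rewrite mulr_ge0 ?(ltW P2)// invr_ge0 mulr_ge0// sqr_ge0.
  have m1 := normc_multiplier_le1 (lnn n) (shifts k0 K).
  have an := aP n; rewrite n2 -ltnS nN in an; have {}an := an isT.
  apply: (@le_trans _ _ (Phi n / n%:R * normc (multiplier (lnn n) (shifts k0 K)))).
    by rewrite mulrA ler_wpM2r ?normc_ge0// ler_wpM2r// invr_ge0.
  case: ltnP => nT.
    by rewrite (@le_trans _ _ (Phi n / n%:R)) ?lerDl// ler_piMr ?F0.
  rewrite add0r; have := @normc_multiplier_shifts k0 K n.
  rewrite nT (leq_trans _ NK)// => /(_ isT) h.
  apply: le_trans (ler_wpM2l (F0 n n2) h) _.
  have Pn := Phi_gt0 n2.
  by rewrite le_eqVlt; apply/orP; left; apply/eqP; field; rewrite !gt_eqF.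
rewrite big_split/=; apply: lerD.
  apply: (@le_trans _ _ (\sum_(2 <= n < maxn N.+1 (T k0)) (if (n < T k0)%N then Phi n / n%:R else 0))).
    rewrite [leRHS](big_cat_nat _ (n := N.+1)) ?leq_max ?leqnn ?(leq_trans N2 (leqnSn N))//=.
    rewrite lerDl big_nat_cond sumr_ge0// => n /andP[/andP[n1 _] _].
    by case: ifP => // _; rewrite F0// (leq_trans N2 (ltnW n1)).
  by rewrite -big_mkcond/= [leRHS](big_nat_widen _ _ (maxn N.+1 (T k0))) ?leq_maxr.
rewrite -mulr_sumr ler_wpM2l ?(ltW P2)//.
by apply: sum_log_weight_le => //; exact: leqW.
Qed.

Lemma not_dense : ~ dense_in_L2 H (dirichlet_polys Phi).
Proof.
move=> [_ dense].
(* One half of the interval serves as window of integration, the other as room for the shifts. *)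
pose d := H / 2; have d0 : 0 < d by rewrite divr_gt0.
have [k0 k0P] := sum_shifts_small d0.
pose C := \sum_(2 <= n < T k0) Phi n / n%:R + Phi 2 * (2 / ln 2).
have C0 : 0 <= C.
  have P2 : 0 < Phi 2 by exact: Phi_gt0.
  rewrite addr_ge0//; last by rewrite mulr_ge0 ?(ltW P2)// divr_ge0// ltW// lnn_gt0.
  rewrite big_nat_cond sumr_ge0// => n /andP[/andP[n2 _] _].
  by rewrite divr_ge0// ltW// Phi_gt0.
(* The averaged error is then at least [1 + 1 / d] everywhere, and [(1 + 1 / d)^2 d = d + 2 + 1 / d]
   exceeds the squared error 1 allowed by density. *)
pose lam : R := C + (1 + d^-1).
have di0 : 0 < d^-1 by rewrite invr_gt0.
have lam0 : 0 <= lam by rewrite /lam; lra.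
have cl : ccontinuous (fun=> lam%:C : R[i]) := ccontinuous_cst _.
have ml := ccontinuous_measurable H cl.
have lamL2 : L2 H (fun=> lam%:C).
  case: (ml) => m1 m2; split => //; apply/L2norm_lty.
  apply: le_lt_trans (sqint_bounded ml lam0 (ltW H_gt0) _) _; last exact: ltry.
  by move=> x _; rewrite normc_real ger0_norm.
have [g Sg gl] := dense _ lamL2 1 ltr01.
have {gl} := sqint_lt_of_L2norm ltr01 gl; rewrite expr1n.
have [N [a [N2 aP gE]]] := Sg.
(* The number of blocks depends on the polynomial, so that they cover all its frequencies from
   [T k0] on; the total shift stays at most [d] regardless. *)
pose K := N.+1; pose l := shifts k0 K.
have NK : (N < T K)%N by rewrite ltnW// ltn_tower.
pose E (t : R) := normc (lam%:C - g t) ^+ 2.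
have cE : continuous E.
  have [cr ci] := ccontinuousD cl (ccontinuousZ (-1) (ccontinuous_dirichlet Sg)).
  rewrite (_ : E = fun t => complex.Re (lam%:C + -1 * g t) * complex.Re (lam%:C + -1 * g t) +
      complex.Im (lam%:C + -1 * g t) * complex.Im (lam%:C + -1 * g t)).
    move=> t; apply: cvgD; first by apply: cvgM; exact: cr.
    by apply: cvgM; exact: ci.
  by apply/funext => t; rewrite /E sqr_normc_ReIm mulN1r -!expr2.
have E0 t : 0 <= E t by rewrite sqr_ge0.
have avgE t : (1 + d^-1) ^+ 2 <= avg l E t.
  apply: le_trans (sqr_normc_avg_le l (fun t => lam%:C - g t) t).
  rewrite avgB avg_cst ?pnatr_eq0//.
  have h : normc (avg l g t) <= C by rewrite gE avg_dirichlet_le.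
  rewrite lerXn2r ?nnegrE ?normc_ge0 ?addr_ge0 ?invr_ge0 ?(ltW d0)//.
  have := normc_D_le (lam%:C - avg l g t) (avg l g t).
  rewrite subrK normc_real ger0_norm// /lam; lra.
apply/negP; rewrite -leNgt.
have i1 : (((1 + d^-1) ^+ 2 * d)%:E <= \int[lebesgue_measure]_(x in `[0%R, d]) (avg l E x)%:E)%E.
  have -> : (((1 + d^-1) ^+ 2 * d)%:E =
      \int[lebesgue_measure]_(x in `[0%R, d]) (cst ((1 + d^-1) ^+ 2)%:E x))%E.
    transitivity (((1 + d^-1) ^+ 2)%:E * lebesgue_measure (`[0%R, d]%classic : set R))%E.
      by rewrite lebesgue_measure_itv/= lte_fin d0 -EFinD subr0 -EFinM.
    by rewrite integral_cst.
  apply: ge0_le_integral => //.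
  - by move=> x _; rewrite lee_fin sqr_ge0.
  - apply/measurable_EFinP; apply: measurable_funTS; apply: continuous_measurable_fun.
    exact: continuous_avg.
  by move=> x _; rewrite lee_fin.
have i2 := integral_avg_le (ltW d0) cE E0 (shifts_ge0 k0 K).
have i3 : (\int[lebesgue_measure]_(x in `[0%R, (d + \sum_(e <- l) e)%R]) (E x)%:E <=
   \int[lebesgue_measure]_(x in `[0%R, H]) (E x)%:E)%E.
  apply: integral_itv_continuous_le => //.
  by have := k0P K; rewrite /d => h; lra.
have i4 : (\int[lebesgue_measure]_(x in `[0%R, H]) (E x)%:E = sqint H (fun t => (lam%:C - g t)%R))%E.
  rewrite integral_itv_bndoo//.
  by apply/measurable_EFinP; apply: measurable_funTS; exact: continuous_measurable_fun.
rewrite -i4; apply: le_trans i3; apply: le_trans i2; apply: le_trans i1.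
rewrite lee_fin.
have -> : (1 + d^-1) ^+ 2 * d = d + 2 + d^-1 by field; rewrite gt_eqF.
have : 0 < d^-1 by rewrite invr_gt0.
lra.
Qed.

End NotDense.

Theorem mainTheorem1 (R : realType) (H : R) (Phi : nat -> R)
  (H_gt0 : 0 < H)
  (Phi_gt0 : forall n, (2 <= n)%N -> 0 < Phi n)
  (Phi_incr : forall m n, (2 <= m)%N -> (m <= n)%N -> Phi m <= Phi n) :
  dense_in_L2 H (dirichlet_polys Phi)
  <->
  (fun N : nat => \sum_(2 <= n < N) ln (Phi n) / (n%:R * ln (n%:R) ^+ 2))
    @ \oo --> +oo.
Proof.
split=> [dense|div]; last first.
  apply: dense_of_small_approx => // y y0 eta eta0.
  exact: (exp_approx Phi_gt0 Phi_incr (ltW H_gt0) y0 eta0 div).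
have w0 n : 0 <= (n%:R * ln (n%:R : R) ^+ 2)^-1.
  by rewrite invr_ge0 mulr_ge0// sqr_ge0.
pose A N : R := \sum_(2 <= n < N) psi Phi n / (n%:R * ln n%:R ^+ 2).
have Ainc M N : (M <= N)%N -> A M <= A N.
  move=> MN; have [M2|M2] := ltnP M 2.
    rewrite /A big_geq ?(ltnW M2)// big_nat_cond sumr_ge0// => n /andP[/andP[n2 _] _].
    by rewrite mulr_ge0 ?psi_ge0.
  rewrite /A (big_cat_nat _ (n := M) (p := N))//= lerDl big_nat_cond sumr_ge0// => n /andP[/andP[n2 _] _].
  by rewrite mulr_ge0 ?psi_ge0// (leq_trans M2).
(* The partial sums [A] increase, so they are either bounded, which density excludes, or tend to
   infinity. *)
have [[B BP]|unb] := pselect (exists B, forall N, A N <= B).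
  by have := not_dense Phi_gt0 Phi_incr BP H_gt0 dense.
apply/cvgryPge => c.
(* A bound, from the convergence of the sum of the weights, for the change in the partial sums when
   [psi] is replaced by [ln (Phi n)]. *)
pose b := `|ln (Phi 2)| * (2 / ln 2).
have [N0 N0P] : exists N, c + b <= A N.
  apply: contrapT => h; apply: unb; exists (c + b) => N; rewrite leNgt; apply/negP => cN.
  by apply: h; exists N; exact: ltW.
exists (maxn N0 2) => // N /=; rewrite geq_max => /andP[NN N2].
have W : \sum_(2 <= n < N) (n%:R * ln (n%:R : R) ^+ 2)^-1 <= 2 / ln 2 :> R.
  exact: sum_log_weight_le.
have -> : \sum_(2 <= n < N) ln (Phi n) / (n%:R * ln n%:R ^+ 2) =
    A N + ln (Phi 2) * \sum_(2 <= n < N) (n%:R * ln n%:R ^+ 2)^-1.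
  rewrite /A mulr_sumr -big_split/=; apply: eq_bigr => n _.
  by rewrite -mulrDl /psi subrK.
have h1 : - b <= ln (Phi 2) * \sum_(2 <= n < N) (n%:R * ln n%:R ^+ 2)^-1.
  have : `|ln (Phi 2) * \sum_(2 <= n < N) (n%:R * ln n%:R ^+ 2)^-1| <= b.
    rewrite normrM ler_wpM2l// ger0_norm//.
    by rewrite sumr_ge0// => n _; exact: w0.
  by rewrite ler_norml => /andP[].
have := Ainc _ _ NN; lra.
Qed.
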